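(* For any sequence $\{\varepsilon_n\}_{n=0}^\infty$ of positive real numbers with $\varepsilon_n \to 0$ and any real $\lambda_0>0$, there exist a nonnegative function $g \in \bigcap_{p>1} L^p(\mathbb{R})$ and a sequence $\{\lambda_n\}_{n=1}^{\infty}$ of positive real numbers satisfying $$\lambda_{n+1} / \lambda_n > 1 + \varepsilon_n, \quad n = 0,1,2,\dots,$$ such that the system of translates $\{g(x - \lambda_n)\}_{n=1}^{\infty}$ is complete in the space $L^p(\mathbb{R})$ for every $p>1$.
   Context: Here $p$ ranges over real numbers $1<p<\infty$, and $L^p(\mathbb{R})$ is the (complex) Lebesgue space. A system of vectors in a topological vector space is called complete if its finite linear combinations are dense in the space. *)

(* Defs.v *)
#[export] Set Warnings "-notation-overridden,-notation-incompatible-prefix,-ambiguous-paths".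
From mathcomp Require Export all_boot all_order all_algebra.
From mathcomp Require Export complex.
From mathcomp Require Export all_classical all_reals all_analysis.
Export Order.TTheory GRing.Theory Num.Theory.
Export numFieldNormedType.Exports.

Set Implicit Arguments.
Unset Strict Implicit.
Unset Printing Implicit Defensive.

Local Open Scope classical_set_scope.
Local Open Scope ring_scope.

Section ComplexLp.
Context {R : realType}.
Implicit Types (p : R) (f : R -> R[i]) (v : nat -> R -> R[i]).

Definition cLnorm p f : \bar R :=
  Lnorm (@lebesgue_measure R) p%:E (EFin \o (@Normc.normc R \o f)).

(* [R[i]] carries no sigma-algebra in the library; Borel measurability of a
   complex function is that of its real and imaginary parts.  Functions are not
   quotiented by almost-everywhere equality: [cLnorm p] is the seminorm that
   induces the norm of the quotient, so density is the same in both. *)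
Definition cLfun p : set (R -> R[i]) :=
  [set f : R -> R[i] | [/\ measurable_fun [set: R] (@complex.Re R \o f),
               measurable_fun [set: R] (@complex.Im R \o f) &
               (cLnorm p f < +oo)%E]].

Definition finite_lincomb v : set (R -> R[i]) :=
  [set h : R -> R[i] | exists (N : nat) (c : nat -> R[i]),
             h = (fun x => \sum_(k < N) c k * v k x)].

Definition complete_in_Lp p v : Prop :=
  (forall n, cLfun p (v n)) /\
  (forall f, cLfun p f -> forall e : R, 0 < e ->
     exists2 h, finite_lincomb v h & (cLnorm p (f \- h)%R < e%:E)%E).

Definition translate (g : R -> R) (a : R) : R -> R[i] :=
  fun x => real_complex R (g (x - a)).

End ComplexLp.

(* Main.v *)
From HB Require Import structures.
Require Import Defs.
From mathcomp Require Import measurable_realfun.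
From mathcomp Require Import ring lra zify.

Set Implicit Arguments.
Unset Strict Implicit.
Unset Printing Implicit Defensive.

Import complex.ComplexField.
Import HBSimple HBNNSimple.

Local Open Scope classical_set_scope.
Local Open Scope ring_scope.

(** Why the theorem is true.

    The function [g] is an increasing limit of nonnegative functions with
    compact support, starting from the indicator of ]0, 1].  One stage replaces
    [f] by [f'(x) = sum_j G_j f(x - (j - S) D)], where [G] is a polynomial close
    to ['X^S] and [D] is huge, and it reserves for [lambda] a block of points
    [a + D, a + 2D, ..., a + ND] with [a] rational.  Consecutive points of such a
    block have ratio about [1 + 1/N] at least, and [N] depends on polynomials
    chosen before [D] and before the position of the block.  As [eps] tends to
    0, padding [lambda] with arbitrary sparse points until [eps] is below
    [1/(2N)] makes the ratio condition hold inside the block; a large [D] makes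
    it hold at its entrance.

    The polynomials come in a pair [c], [G] ([cancelling_pair]).  The
    coefficients of [G - 'X^S] are nonnegative and small in every l^p with
    [p >= p0 > 1], the polynomial [c] has no constant term, and [c G - G] is
    small in l^1.  Read on [f'], the last fact says that
    [sum_(j >= 1) c_j f'(x - a - j D)] is close to [f'(x - a)]: the reserved
    translates of [f'] nearly span the translate by [a].  The first fact says
    that [f' - f] is nonnegative and small in L^p, since for large [D] the
    shifts of [f] have disjoint supports and the L^p norm of a combination
    factors through the l^p norm of its coefficients.

    This is where [p > 1] enters.  The polynomial [F = 1 - c] has value 1 at the
    origin, so by Jensen's formula it cannot be uniformly small on the unit
    circle.  It is made tiny off an arc around [-1] only ([damped]), and [G]
    has to be tiny on that arc.  A nonnegative perturbation of ['X^S] with this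
    property must have total mass at least about 1, but the mass can be spread
    over many coefficients.  Up to the factor ['X^S], [G] is [1 + H], where [H]
    is a smoothed autocorrelation of positive nodes near 0 and negative nodes
    near [pi]: an autocorrelation has nonnegative coefficients, and the
    cross-correlation of the two groups makes [H] nearly [-1] around [pi]
    ([bumpfun_flat]).

    Since [G] has no zero on the circle, a Neumann series inverts it up to an
    arbitrarily small l^1 error, so ]0, 1] remains a combination of rational
    translates of [f'] up to a small error in all L^p ([recovers_box]).  Each
    stage takes its tolerance small against the l^1 norms of all combinations
    chosen so far; the relations found at stage [k] then survive, with a small
    error, in the limit [g].  Every rational [a] is used infinitely often, so the
    closed span of the translates of [g] contains [g(x - a)] for all rational
    [a], and then all rational translates of the indicator of ]0, 1].

    Again for [p > 1], averaging [n] integer translates of a function supported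
    in ]0, 1] costs a factor [n ^ (1/p - 1)], which tends to 0; telescoping this way
    produces from ]0, 1] the indicators of all short intervals
    ([approx_ind_short]), hence those of all bounded Borel sets, hence all of
    L^p ([approx_all]).  Complex functions are treated through their real and
    imaginary parts. *)

(** * Coefficients of a polynomial and its values on the unit circle *)
Section Circle.
Context {R : realType}.
Local Notation toC := (real_complex R).
Local Notation normc := (@Normc.normc R).
Local Notation pi := (@trigo.pi R).

Definition expi (t : R) : R[i] := Complex (cos t) (sin t).

Lemma expiD a b : expi (a + b) = expi a * expi b.
Proof.
rewrite /expi cosD sinD; apply/eqP; rewrite eq_complex /=.
by apply/andP; split=> //; apply/eqP; ring.
Qed.

Lemma expi0 : expi 0 = 1.
Proof. by rewrite /expi cos0 sin0. Qed.

Lemma expi_mulrn a n : expi (n%:R * a) = expi a ^+ n.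
Proof.
elim: n => [|n IH]; first by rewrite mul0r expi0.
by rewrite -natr1 mulrDl mul1r expiD IH exprSr.
Qed.

Lemma expiNM a : expi (- a) * expi a = 1.
Proof. by rewrite -expiD addNr expi0. Qed.

Lemma expi2pi : expi (pi *+ 2) = 1.
Proof. by rewrite /expi cos2pi sin2pi. Qed.

Lemma normc_expi t : normc (expi t) = 1.
Proof. by rewrite /= cos2Dsin2 sqrtr1. Qed.

Lemma cos_lt1 x : 0 < x < pi *+ 2 -> cos x < 1.
Proof.
move=> /andP[x0 x2].
have -> : x = (x / 2) *+ 2 by rewrite -mulr_natr; field.
rewrite cos_mulr2n cos2sin2.
suff : 0 < sin (x / 2) by nra.
by apply: sin_gt0_pi; apply/andP; split; move: x2; rewrite mulr2n; lra.
Qed.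

Lemma expi_sum0 n d : (0 < d < n)%N ->
  \sum_(k < n) expi (k%:R * (d%:R * (pi *+ 2 / n%:R))) = 0.
Proof.
move=> /andP[d0 dn].
have n0 : (n%:R : R) != 0 by rewrite pnatr_eq0; lia.
have n0' : 0 < (n%:R : R) by rewrite ltr0n; lia.
set z := expi (d%:R * (pi *+ 2 / n%:R)).
have zn : z ^+ n = 1.
  rewrite /z -expi_mulrn.
  have -> : n%:R * (d%:R * (pi *+ 2 / n%:R)) = d%:R * (pi *+ 2) :> R by field.
  by rewrite expi_mulrn expi2pi expr1n.
have z1 : z - 1 != 0.
  rewrite subr_eq0; apply/eqP => /(congr1 (@complex.Re R)) /= h.
  suff : cos (d%:R * (pi *+ 2 / n%:R)) < 1 :> R by rewrite h ltxx.
  have p2 : 0 < pi *+ 2 :> R by rewrite mulr2n; have := @pi_gt0 R; lra.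
  apply: cos_lt1; apply/andP; split.
    by apply: mulr_gt0; [rewrite ltr0n|apply: divr_gt0].
  rewrite mulrCA gtr_pMr // ltr_pdivrMr // mul1r ltr_nat //.
apply: (mulfI z1); rewrite mulr0.
under eq_bigr do rewrite expi_mulrn -/z.
by rewrite -subrX1 zn subrr.
Qed.

Lemma conjc_expi t : conjc (expi t) = expi (- t).
Proof. by rewrite /expi cosN sinN. Qed.

Lemma expi_sum0N n d : (0 < d < n)%N ->
  \sum_(k < n) expi (- (k%:R * (d%:R * (pi *+ 2 / n%:R)))) = 0.
Proof.
move=> h; under eq_bigr do rewrite -conjc_expi.
by rewrite -rmorph_sum expi_sum0 // rmorph0.
Qed.

(** Orthogonality of the characters of the group of [n]-th roots of unity; the two
    hypotheses say [`|i - j| < n], so that [n] divides [i - j] only when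
    [i = j]. *)
Lemma expi_orth n i j : (i < n + j)%N -> (j < n + i)%N ->
  \sum_(k < n) expi (k%:R * ((i%:R - j%:R) * (pi *+ 2 / n%:R)))
  = if i == j then n%:R else 0.
Proof.
move=> h1 h2; case: eqP => [->|ij].
  under eq_bigr do rewrite subrr mul0r mulr0 expi0.
  by rewrite sumr_const card_ord.
have [lij|lji] := ltnP i j.
  rewrite -[RHS](@expi_sum0N n (j - i)); last lia.
  by apply: eq_bigr => k _; rewrite natrB ?(ltnW lij) //; congr expi; ring.
rewrite -[RHS](@expi_sum0 n (i - j)); last lia.
by apply: eq_bigr => k _; rewrite natrB.
Qed.

Lemma sqr_normc (z : R[i]) : normc z ^+ 2 = complex.Re z ^+ 2 + complex.Im z ^+ 2.
Proof. by case: z => a b /=; rewrite sqr_sqrtr // addr_ge0 // sqr_ge0. Qed.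

Lemma normc_ge0 (z : R[i]) : 0 <= normc z.
Proof. by case: z => a b; apply: sqrtr_ge0. Qed.

Lemma normr_Re_le (z : R[i]) : `|complex.Re z| <= normc z.
Proof.
by rewrite -ler_sqr ?nnegrE ?normc_ge0 // sqr_normc real_normK ?num_real // lerDl sqr_ge0.
Qed.

Lemma normr_Im_le (z : R[i]) : `|complex.Im z| <= normc z.
Proof.
by rewrite -ler_sqr ?nnegrE ?normc_ge0 // sqr_normc real_normK ?num_real // lerDr sqr_ge0.
Qed.

Lemma normcX (z : R[i]) n : normc (z ^+ n) = normc z ^+ n.
Proof.
elim: n => [|n IH]; first by rewrite !expr0 Normc.normc1.
by rewrite !exprS Normc.normcM IH.
Qed.

Lemma normc_sum I (s : seq I) (f : I -> R[i]) :
  normc (\sum_(i <- s) f i) <= \sum_(i <- s) normc (f i).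
Proof.
elim: s => [|x s IH]; first by rewrite !big_nil Normc.normc0.
rewrite !big_cons; apply: le_trans (le_normcD _ _) _.
by rewrite lerD2l.
Qed.

Lemma normc_real x : normc (toC x) = `|x|.
Proof. by rewrite /= expr0n /= addr0 sqrtr_sqr. Qed.

(** Fourier inversion on the [n]-th roots of unity, with [n] the size of [P]: each
    coefficient is an average of unimodular multiples of values on the circle. *)
Lemma coef_le_sup (P : {poly R}) (B : R) :
  (forall t, 0 <= t <= pi *+ 2 -> normc (map_poly toC P).[expi t] <= B) -> forall j, `|P`_j| <= B.
Proof.
move=> hB j.
have pi2 : 0 <= pi *+ 2 by rewrite mulrn_wge0 ?pi_ge0.
have B0 : 0 <= B by apply: (le_trans (normc_ge0 _) (hB 0 _)); rewrite lexx.
have [sj|js] := leqP (size P) j; first by rewrite nth_default // normr0.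
set n := size P in js *; have n0 : (0 < n)%N by apply: leq_ltn_trans js.
set w := pi *+ 2 / n%:R : R.
have key : \sum_(k < n) (map_poly toC P).[expi (k%:R * w)] * expi (- (k%:R * (j%:R * w)))
   = n%:R * toC P`_j.
  transitivity (\sum_(k < n) \sum_(i < n)
      toC P`_i * expi (k%:R * ((i%:R - j%:R) * w))).
    apply: eq_bigr => k _; rewrite horner_poly big_distrl /=.
    apply: eq_bigr => i _; rewrite -expi_mulrn -mulrA -expiD.
    by congr (_ * expi _); ring.
  rewrite exchange_big /=.
  have E (i : 'I_n) : \sum_(k < n) toC P`_i * expi (k%:R * ((i%:R - j%:R) * w))
      = if i == j :> nat then toC P`_j * n%:R else 0.
    rewrite -big_distrr /= expi_orth.
    - by case: eqP => [->|_]; rewrite ?mulr0.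
    - by have := ltn_ord i; lia.
    - by lia.
  rewrite (eq_bigr _ (fun i _ => E i)) (bigD1 (Ordinal js)) //= eqxx.
  rewrite big1 ?addr0 1?mulrC // => i.
  by rewrite -val_eqE /= => /negbTE ->.
have : normc (n%:R * toC P`_j) <= n%:R * B.
  rewrite -key; apply: le_trans (normc_sum _ _) _.
  apply: (@le_trans _ _ (\sum_(k < n) B)).
    apply: ler_sum => k _; rewrite Normc.normcM normc_expi mulr1.
    apply: hB; rewrite mulr_ge0 ?divr_ge0 ?ler0n //=.
    by rewrite mulrCA ler_piMr // ler_pdivrMr ?ltr0n // mul1r ler_nat ltnW.
  by rewrite sumr_const card_ord mulr_natl.
rewrite Normc.normcM normc_real -(rmorph_nat toC) normc_real normr_nat.
by rewrite ler_pM2l // ltr0n.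
Qed.

Definition l1 (P : {poly R}) : R := \sum_(j < size P) `|P`_j|.

(** This crude passage from sup norm to l^1 norm loses a factor linear in the
    degree; it suffices because sup norms will decay geometrically in the degree. *)
Lemma l1_le_sup (P : {poly R}) (B : R) n : (size P <= n)%N ->
  (forall t, 0 <= t <= pi *+ 2 -> normc (map_poly toC P).[expi t] <= B) ->
  l1 P <= n%:R * B.
Proof.
move=> sn hB.
have pi2 : 0 <= pi *+ 2 by rewrite mulrn_wge0 ?pi_ge0.
have B0 : 0 <= B by apply: (le_trans (normc_ge0 _) (hB 0 _)); rewrite lexx.
apply: (@le_trans _ _ (\sum_(j < size P) B)).
  by apply: ler_sum => j _; apply: coef_le_sup.
by rewrite sumr_const card_ord mulr_natl -!(mulr_natl B) ler_wpM2r // ler_nat.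
Qed.

End Circle.

(** * Autocorrelations smoothed by a cosine kernel *)
Section Kernel.
Context {R : realType}.
Local Notation toC := (real_complex R).
Local Notation pi := (@trigo.pi R).

Lemma toC_sum (I : Type) (s : seq I) (f : I -> R) :
  toC (\sum_(i <- s) f i) = \sum_(i <- s) toC (f i).
Proof. exact: (rmorph_sum toC). Qed.

Lemma toCM x y : toC (x * y) = toC x * toC y.
Proof. exact: (rmorphM toC). Qed.

(** Equal to [`|1 + expi t| ^+ (2 * a)]: up to a constant, a nonnegative
    trigonometric polynomial of degree [a], concentrated at 0, with positive
    (binomial) coefficients. *)
Definition cos_kernel (a : nat) (t : R) : R := (2 + 2 * cos t) ^+ a.

Lemma cos_kernel_ge0 a t : 0 <= cos_kernel a t.
Proof. by apply: exprn_ge0; have := cos_geN1 t; lra. Qed.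

Lemma cos_kernelN a t : cos_kernel a (- t) = cos_kernel a t.
Proof. by rewrite /cos_kernel cosN. Qed.

Lemma cos_kernelD2pi a t : cos_kernel a (t + pi *+ 2) = cos_kernel a t.
Proof. by rewrite /cos_kernel cosD2pi. Qed.

Lemma cos_kernel_expand a t : toC (cos_kernel a t) =
  \sum_(j < (a.*2).+1) 'C(a.*2, j)%:R * expi ((j%:R - a%:R) * t).
Proof.
have h : toC (2 + 2 * cos t) = expi (- t) * (1 + expi t) ^+ 2.
  transitivity (expi (- t) + 2 * (expi (- t) * expi t)
                + (expi (- t) * expi t) * expi t); last ring.
  rewrite expiNM /expi cosN sinN; apply/eqP; rewrite eq_complex /=.
  by apply/andP; split; apply/eqP; ring.
have -> : toC (cos_kernel a t) = toC (2 + 2 * cos t) ^+ a by rewrite /cos_kernel rmorphXn.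
rewrite h exprMn -exprM mul2n exprDn mulr_sumr.
apply: eq_bigr => j _; rewrite expr1n mul1r mulrnAr -mulr_natl; congr (_ * _).
rewrite -!expi_mulrn -expiD; congr expi; ring.
Qed.

(** The degree [a] is below the number [n] of nodes, so summing over equally spaced
    nodes keeps only the mean of the kernel and the sum does not depend on [t]. *)
Lemma cos_kernel_sum n a t : (a < n)%N ->
  \sum_(k < n) cos_kernel a (t + k%:R * (pi *+ 2 / n%:R)) = n%:R * 'C(a.*2, a)%:R.
Proof.
move=> an; apply: complexI; rewrite toC_sum.
under eq_bigr do rewrite cos_kernel_expand.
rewrite exchange_big /=.
have E (j : 'I_(a.*2).+1) : \sum_(k < n) 'C(a.*2, j)%:R *
     expi ((j%:R - a%:R) * (t + k%:R * (pi *+ 2 / n%:R)))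
   = if j == a :> nat then ('C(a.*2, a)%:R * n%:R : R[i]) else 0.
  transitivity ('C(a.*2, j)%:R * expi ((j%:R - a%:R) * t) *
     \sum_(k < n) expi (k%:R * ((j%:R - a%:R) * (pi *+ 2 / n%:R)))).
    rewrite mulr_sumr; apply: eq_bigr => k _.
    by rewrite -mulrA -expiD; congr (_ * expi _); ring.
  rewrite expi_orth; [|by have := ltn_ord j; lia|lia].
  case: eqP => [->|_]; last by rewrite mulr0.
  by rewrite subrr mul0r expi0 mulr1.
rewrite (eq_bigr _ (fun j _ => E j)).
have ha : (a < (a.*2).+1)%N by lia.
rewrite (bigD1 (Ordinal ha)) //= eqxx big1 ?addr0.
  by rewrite toCM !(rmorph_nat toC) mulrC.
by move=> j; rewrite -val_eqE /= => /negbTE ->.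
Qed.

Lemma cos_kernel_sum_le n a t N : (a < n)%N -> (N <= n)%N ->
  \sum_(k < N) cos_kernel a (t + k%:R * (pi *+ 2 / n%:R)) <= n%:R * 'C(a.*2, a)%:R.
Proof.
move=> an Nn; rewrite -(cos_kernel_sum t an).
rewrite -!(big_mkord xpredT (fun k => cos_kernel a (t + k%:R * (pi *+ 2 / n%:R)))).
rewrite (big_cat_nat (leq0n N) Nn) //= lerDl; apply: sumr_ge0 => *; exact: cos_kernel_ge0.
Qed.

Lemma cos_kernel_sum_leN n a t N : (a < n)%N -> (N <= n)%N ->
  \sum_(k < N) cos_kernel a (t - k%:R * (pi *+ 2 / n%:R)) <= n%:R * 'C(a.*2, a)%:R.
Proof.
move=> an Nn; have := cos_kernel_sum_le (- t) an Nn; congr (_ <= _).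
by apply: eq_bigr => k _; rewrite -cos_kernelN; congr cos_kernel; ring.
Qed.

Lemma bin_le_central a j : ('C(a.*2, j) <= 'C(a.*2, a))%N.
Proof.
have inc i : (i < a)%N -> ('C(a.*2, i) <= 'C(a.*2, i.+1))%N.
  move=> ia; have := mul_bin_left a.*2 i.
  have : (0 < 'C(a.*2, i))%N by rewrite bin_gt0; lia.
  move: ('C(a.*2, i)) ('C(a.*2, i.+1)) => x y; nia.
have low d : forall i, (i + d)%N = a -> ('C(a.*2, i) <= 'C(a.*2, a))%N.
  elim: d => [|d IH] i h; first by rewrite -h addn0.
  apply: leq_trans (inc i _) (IH i.+1 _); lia.
have [ja|aj] := leqP j a; first by apply: (low (a - j)%N); lia.
have [j2|j2] := leqP j a.*2; last by rewrite bin_small.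
rewrite -bin_sub //; apply: (low (j - a)%N); lia.
Qed.

(** The binomials of row [2 a] add up to [4 ^ a], and the central one is the
    largest. *)
Lemma central_ge a : 4 ^+ a <= ((a.*2).+1)%:R * 'C(a.*2, a)%:R :> R.
Proof.
rewrite -natrM -natrX ler_nat -[4%N]/(2 ^ 2)%N -expnM mul2n.
rewrite -[2%N]/(1 + 1)%N expnDn.
apply: (@leq_trans (\sum_(i < (a.*2).+1) 'C(a.*2, a)))%N; last by rewrite sum_nat_const card_ord.
apply: leq_sum => i _.
by rewrite !exp1n !muln1; exact: bin_le_central.
Qed.

(** The coefficient of index [j] is that of the kernel at frequency [j - a] times
    the squared modulus of [sum_i w i * expi ((j - a) * x i)]. Squared
    moduli of Fourier coefficients are those of an autocorrelation, which is what
    makes them nonnegative. *)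
Definition autocor_poly (I : finType) (a : nat) (w x : I -> R) : {poly R} :=
  \poly_(j < (a.*2).+1) ('C(a.*2, j)%:R *
    ((\sum_i w i * cos ((j%:R - a%:R) * x i)) ^+ 2 +
     (\sum_i w i * sin ((j%:R - a%:R) * x i)) ^+ 2)).

Lemma sum_expi (I : finType) (w x : I -> R) :
  \sum_i toC (w i) * expi (x i) =
  Complex (\sum_i w i * cos (x i)) (\sum_i w i * sin (x i)).
Proof.
apply/eqP; rewrite eq_complex /= !raddf_sum /=; apply/andP; split.
  by apply/eqP/eq_bigr => i _; rewrite mul0r subr0.
by apply/eqP/eq_bigr => i _; rewrite mul0r addr0.
Qed.

(** On the circle the polynomial is, up to the factor of modulus 1 that makes all
    frequencies nonnegative, the autocorrelation of the measure with masses [w] at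
    [x], smoothed by the kernel. *)
Lemma autocor_poly_horner (I : finType) (a : nat) (w x : I -> R) t :
  (map_poly toC (autocor_poly a w x)).[expi t] =
  expi (a%:R * t) * toC (\sum_i \sum_l w i * w l * cos_kernel a (t + x i - x l)).
Proof.
transitivity (\sum_(j < (a.*2).+1) 'C(a.*2, j)%:R * expi (j%:R * t) *
   ((\sum_i toC (w i) * expi ((j%:R - a%:R) * x i)) *
    (\sum_l toC (w l) * expi (- ((j%:R - a%:R) * x l))))).
  rewrite (@horner_coef_wide _ (a.*2).+1); last first.
    by rewrite (leq_trans (size_poly _ _)) ?size_poly.
  apply: eq_bigr => j _.
  rewrite (_ : (map_poly _ _)`_j = toC (autocor_poly a w x)`_j) ?coef_map //.
  rewrite coef_poly ltn_ord -expi_mulrn toCM (rmorph_nat toC) [LHS]mulrAC; congr (_ * _).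
  rewrite !sum_expi; apply/eqP; rewrite eq_complex /=.
  have -> : \sum_i w i * cos (- ((j%:R - a%:R) * x i)) =
            \sum_i w i * cos ((j%:R - a%:R) * x i).
    by apply: eq_bigr => i _; rewrite cosN.
  have -> : \sum_i w i * sin (- ((j%:R - a%:R) * x i)) =
            - \sum_i w i * sin ((j%:R - a%:R) * x i).
    by rewrite -sumrN; apply: eq_bigr => i _; rewrite sinN mulrN.
  by apply/andP; split; apply/eqP; ring.
rewrite toC_sum mulr_sumr.
under eq_bigr => j _ do rewrite mulr_suml mulr_sumr.
rewrite exchange_big; apply: eq_bigr => i _ /=.
rewrite toC_sum mulr_sumr.
under eq_bigr => j _ do rewrite mulr_sumr mulr_sumr.
rewrite exchange_big; apply: eq_bigr => l _ /=.
rewrite !toCM cos_kernel_expand !mulr_sumr; apply: eq_bigr => j _.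
transitivity (toC (w i) * toC (w l) * 'C(a.*2, j)%:R *
  (expi (j%:R * t) * expi ((j%:R - a%:R) * x i) * expi (- ((j%:R - a%:R) * x l)))).
  ring.
rewrite [RHS](_ : _ = toC (w i) * toC (w l) * 'C(a.*2, j)%:R *
  (expi (a%:R * t) * expi ((j%:R - a%:R) * (t + x i - x l)))); last ring.
by rewrite -!expiD; congr (_ * expi _); ring.
Qed.

End Kernel.

(** * A bump with nonnegative coefficients, nearly -1 around pi *)
Section FlatBump.
Context {R : realType}.
Local Notation toC := (real_complex R).
Local Notation normc := (@Normc.normc R).
Local Notation pi := (@trigo.pi R).

Lemma cos_le_away (b t : R) : 0 <= b <= pi -> b <= t <= pi *+ 2 - b ->
  cos t <= cos b.
Proof.
move=> /andP[b0 bp] /andP[bt t2].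
have p0 := @pi_gt0 R; rewrite mulr2n in t2.
have [tp|pt] := leP t pi.
  rewrite leNgt ltr_cos ?in_itv /= ?b0 ?bp ?tp ?(le_trans b0 bt) //.
  by rewrite -leNgt.
have -> : cos t = cos (pi *+ 2 - t) by rewrite -[RHS]cosN opprB -[RHS]cosD2pi subrK.
rewrite mulr2n leNgt ltr_cos ?in_itv /= ?b0 ?bp //.
  by rewrite -leNgt; lra.
by apply/andP; split; lra.
Qed.

Lemma cos_kernel_le_away a (b t : R) : 0 <= b <= pi -> b <= t <= pi *+ 2 - b ->
  cos_kernel a t <= cos_kernel a b.
Proof.
move=> hb ht; apply: lerXn2r; rewrite ?nnegrE.
- by have := cos_geN1 t; lra.
- by have := cos_geN1 b; lra.
- by have := cos_le_away hb ht; lra.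
Qed.

Let nat_fact1 (k l m : nat) : (m + l < 2 * m)%N -> (3 * m <= k)%N ->
  (l <= k)%N /\ (2 * m <= k - l)%N.
Proof. by move=> *; split; lia. Qed.

Let away_fact (b p s x y z nd : R) : -b <= s -> s <= b ->
  2 * y <= x - z -> x <= nd -> 0 <= z -> nd = p + p -> y = b + b ->
  b <= s + x - (y + z) <= p + p - b.
Proof. by move=> *; apply/andP; split; lra. Qed.

Let central_gt0 a : 0 < 'C(a.*2, a)%:R :> R.
Proof. by rewrite ltr0n bin_gt0 -addnn leq_addr. Qed.

(** There are [n = Q m] equally spaced nodes with step [d] on the circle; [3 m]
    consecutive ones starting at 0 get weight 1, and the [m] nodes opposite to the
    middle third of these get weight -1. A shift by [pi + s] with [`|s| <= b0]
    brings the negative nodes back to the middle third up to half its width, hence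
    well inside the positive block. The width [m d] of a third is [2 b0]. *)
Variables (Q m : nat).
Hypotheses (Q8 : (8 <= Q)%N) (m1 : (0 < m)%N).

Let n := (Q * m)%N.
Let a := n.-1.
Let d : R := pi *+ 2 / n%:R.
Let K : R := n%:R * 'C(a.*2, a)%:R.
Let I : finType := ('I_(3 * m) + 'I_m)%type.
Let w (i : I) : R := if i is inl _ then 1 else -1.
Let x (i : I) : R := match i with inl i => i%:R * d | inr b => pi + (m + b)%:R * d end.
Let b0 := pi / Q%:R.
Let tau := cos_kernel a b0.

Let n0 : (0 < n)%N. Proof. by rewrite muln_gt0 m1 andbT; lia. Qed.
Let an : (a < n)%N. Proof. by rewrite /a prednK. Qed.
Let nR0 : 0 < n%:R :> R. Proof. by rewrite ltr0n. Qed.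
Let mR0 : 0 < m%:R :> R. Proof. by rewrite ltr0n. Qed.
Let QR : 8 <= Q%:R :> R. Proof. by rewrite (ler_nat R 8). Qed.
Let K0 : 0 < K.
Proof. by rewrite mulr_gt0. Qed.
Let p0 := @pi_gt0 R.
Let nd : n%:R * d = pi *+ 2. Proof. by rewrite /d mulrC divfK // gt_eqF. Qed.
Let d0 : 0 < d. Proof. by rewrite divr_gt0 // mulr2n addr_gt0. Qed.
Let Qb : Q%:R * b0 = pi.
Proof. by rewrite /b0 mulrC divfK // gt_eqF // (lt_le_trans _ QR). Qed.
Let md : m%:R * d = b0 *+ 2.
Proof.
apply: (@mulfI _ Q%:R); first by rewrite gt_eqF // (lt_le_trans _ QR).
by rewrite mulrnAr Qb mulrA -natrM nd.
Qed.
Let b00 : 0 < b0. Proof. by rewrite divr_gt0 // (lt_le_trans _ QR). Qed.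
Let b8 : 8 * b0 <= pi. Proof. by rewrite -Qb ler_wpM2r // ltW. Qed.

Let S t := \sum_i \sum_l w i * w l * cos_kernel a (t + x i - x l).
(** The division by [2 m K] normalizes the two cross-correlations, each close to
    [m K] around [pi], to a total of -1. *)
Definition bumpfun t := S t / (2 * m%:R * K).
Definition bumppoly : {poly R} := (2 * m%:R * K)^-1 *: autocor_poly a w x.

(** [AA], [BB], [AB], [BA] are the correlations between the positive block [A] and
    the negative block [B]. *)
Let AA t := \sum_(i < 3 * m) \sum_(l < 3 * m) cos_kernel a (t + i%:R * d - l%:R * d).
Let BB t := \sum_(i < m) \sum_(l < m) cos_kernel a (t + (m + i)%:R * d - (m + l)%:R * d).
Let AB t := \sum_(l < m) \sum_(i < 3 * m) cos_kernel a (t - pi - (m + l)%:R * d + i%:R * d).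
Let BA t := \sum_(l < m) \sum_(i < 3 * m) cos_kernel a (t + pi + (m + l)%:R * d - i%:R * d).

Let S_blocks t : S t = AA t + BB t - AB t - BA t.
Proof.
rewrite /S !big_sumType /=.
under eq_bigr => i _ do rewrite big_sumType /=.
under [X in _ + X]eq_bigr => i _ do rewrite big_sumType /=.
rewrite !big_split /=.
have -> : \sum_(i < 3 * m) \sum_(l < 3 * m) 1 * 1 * cos_kernel a (t + i%:R * d - l%:R * d) = AA t.
  by apply: eq_bigr => i _; apply: eq_bigr => l _; rewrite !mul1r.
have -> : \sum_(i < m) \sum_(l < m) -1 * -1 * cos_kernel a (t + (pi + (m + i)%:R * d) - (pi + (m + l)%:R * d)) = BB t.
  apply: eq_bigr => i _; apply: eq_bigr => l _; rewrite mulrNN !mul1r.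
  by congr cos_kernel; ring.
have -> : \sum_(i < 3 * m) \sum_(l < m) 1 * -1 * cos_kernel a (t + i%:R * d - (pi + (m + l)%:R * d)) = - AB t.
  rewrite exchange_big -sumrN; apply: eq_bigr => i _ /=; rewrite -sumrN.
  by apply: eq_bigr => l _; rewrite mul1r mulN1r; congr (- cos_kernel _ _); ring.
have -> : \sum_(i < m) \sum_(l < 3 * m) -1 * 1 * cos_kernel a (t + (pi + (m + i)%:R * d) - l%:R * d) = - BA t.
  rewrite -sumrN; apply: eq_bigr => i _ /=; rewrite -sumrN.
  by apply: eq_bigr => l _; rewrite mulr1 mulN1r; congr (- cos_kernel _ _); ring.
ring.
Qed.

Let m3n : (3 * m <= n)%N. Proof. by rewrite /n; nia. Qed.
Let mn : (m <= n)%N. Proof. by rewrite /n; nia. Qed.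

Let le_card k (F : 'I_k -> R) B : (forall i, F i <= B) -> \sum_(i < k) F i <= k%:R * B.
Proof.
move=> h; apply: (@le_trans _ _ (\sum_(i < k) B)); first exact: ler_sum.
by rewrite sumr_const card_ord mulr_natl.
Qed.

Let sum2_ge0 k l (F : 'I_k -> 'I_l -> R) :
  0 <= \sum_(i < k) \sum_(j < l) cos_kernel a (F i j).
Proof. by do 2!(apply: sumr_ge0 => ? _); exact: cos_kernel_ge0. Qed.

Let AA_le t : AA t <= (3 * m)%:R * K.
Proof. by apply: le_card => i; exact: cos_kernel_sum_leN. Qed.

Let BB_le t : BB t <= m%:R * K.
Proof.
apply: le_card => i; rewrite [leLHS](_ : _ = \sum_(l < m)
   cos_kernel a ((t + (m + i)%:R * d - m%:R * d) - l%:R * d)); first exact: cos_kernel_sum_leN.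
by apply: eq_bigr => l _; rewrite natrD; congr cos_kernel; ring.
Qed.

Let AB_le t : AB t <= m%:R * K.
Proof. by apply: le_card => i; exact: cos_kernel_sum_le. Qed.

Let BA_le t : BA t <= m%:R * K.
Proof. by apply: le_card => i; exact: cos_kernel_sum_leN. Qed.

Let mK0 : 0 < m%:R * K. Proof. exact: mulr_gt0. Qed.

(** Each correlation is nonnegative and at most its number of rows times the full
    kernel sum [K]: [3 m K] for [AA], and [m K] for the three others, after the
    order of summation that suits each. *)
Lemma bumpfun_bounds t : -1 <= bumpfun t <= 2.
Proof.
rewrite /bumpfun S_blocks.
have D0 : 0 < 2 * m%:R * K by rewrite -mulrA mulr_gt0.
rewrite ler_pdivlMr // ler_pdivrMr //.
have := AA_le t; have := BB_le t; have := AB_le t; have := BA_le t.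
have := mK0; rewrite natrM -!mulrA; set y := m%:R * K => y0.
have : 0 <= AA t by exact: sum2_ge0.
have : 0 <= BB t by exact: sum2_ge0.
have : 0 <= AB t by exact: sum2_ge0.
have : 0 <= BA t by exact: sum2_ge0.
by move=> *; apply/andP; split; lra.
Qed.

Lemma bumppoly_horner t :
  (map_poly toC bumppoly).[expi t] = expi (a%:R * t) * toC (bumpfun t).
Proof.
rewrite /bumppoly map_polyZ hornerZ autocor_poly_horner mulrCA -toCM.
by congr (_ * toC _); exact: mulrC.
Qed.

Lemma size_bumppoly : (size bumppoly <= (a.*2).+1)%N.
Proof. by apply: leq_trans (size_scale_leq _ _) _; exact: size_poly. Qed.

Lemma bumppoly_ge0 j : 0 <= bumppoly`_j.
Proof.
rewrite coefZ mulr_ge0 //; first by rewrite invr_ge0 -mulrA mulr_ge0 // ltW.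
rewrite coef_poly; case: ifP => // _.
by rewrite mulr_ge0 // addr_ge0 // sqr_ge0.
Qed.

(** The [4 m] unimodular terms give at most [(4 m) ^ 2], the binomial is at most
    the central one, and [8 / Q] is what remains of [16 m ^ 2] after division
    by [2 m n], with [n = Q m]. So the coefficients get small with [1 / Q]
    while their sum stays bounded. *)
Lemma bumppoly_le j : bumppoly`_j <= 8 / Q%:R.
Proof.
rewrite coefZ coef_poly; case: ifP => [_|_]; last by rewrite mulr0 divr_ge0.
set X := _ ^+ 2 + _ ^+ 2.
have hX : X <= (4 * m)%:R ^+ 2.
  have := normc_sum (index_enum I) (fun i => toC (w i) * expi ((j%:R - a%:R) * x i)).
  rewrite sum_expi => h.
  have {}h : normc (Complex (\sum_i w i * cos ((j%:R - a%:R) * x i))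
       (\sum_i w i * sin ((j%:R - a%:R) * x i))) <= (4 * m)%:R.
    apply: le_trans h _.
    under eq_bigr => i _.
      rewrite Normc.normcM normc_expi mulr1 normc_real.
      rewrite (_ : `|w i| = 1); last by case: i => ? /=; rewrite ?normrN normr1.
      over.
    by rewrite sumr_const card_sum !card_ord ler_nat -mulSnr.
  have X0 : 0 <= X by rewrite addr_ge0 // sqr_ge0.
  rewrite -(sqr_sqrtr X0) lerXn2r ?nnegrE ?sqrtr_ge0 //.
have C0 := central_gt0 a.
have hC : 'C(a.*2, j)%:R <= 'C(a.*2, a)%:R :> R by rewrite ler_nat bin_le_central.
apply: (@le_trans _ _ ((2 * m%:R * K)^-1 * ('C(a.*2, a)%:R * (4 * m)%:R ^+ 2))).
  apply: ler_wpM2l; first by rewrite invr_ge0 -mulrA mulr_ge0 // ltW.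
  by apply: ler_pM => //; rewrite addr_ge0 ?sqr_ge0.
rewrite le_eqVlt; apply/orP; left; apply/eqP.
rewrite /K /n !natrM; field.
by rewrite !gt_eqF // (lt_le_trans _ QR).
Qed.

Let in_away k l s : `|s| <= b0 -> (m + l < 2 * m)%N -> (3 * m <= k < n)%N ->
  b0 <= s + k%:R * d - (m + l)%:R * d <= pi *+ 2 - b0.
Proof.
rewrite ler_norml => /andP[s1 s2] hl /andP[k1 k2].
have [lk h] := nat_fact1 hl k1.
rewrite natrD mulrDl mulr2n; apply: (away_fact s1 s2 (nd := n%:R * d)).
- by rewrite mulrA -natrM -mulrBl -natrB // ler_wpM2r ?(ltW d0) // ler_nat.
- by rewrite ler_wpM2r ?(ltW d0) // ler_nat ltnW.
- by rewrite mulr_ge0 ?(ltW d0).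
- by rewrite nd mulr2n.
- by rewrite md mulr2n.
Qed.

Let tau_ge t : b0 <= t <= pi *+ 2 - b0 -> cos_kernel a t <= tau.
Proof. by have h1 := b8; have h2 := b00; apply: cos_kernel_le_away; apply/andP; split; lra. Qed.

Let tau0 : 0 <= tau. Proof. exact: cos_kernel_ge0. Qed.

(** A full turn of the kernel sums to [K], and the missing nodes all lie in the tail
    of the kernel. *)
Let sum_tail s (l : 'I_m) : `|s| <= b0 ->
  K - n%:R * tau <= \sum_(i < 3 * m) cos_kernel a (s - (m + l)%:R * d + i%:R * d).
Proof.
move=> hs; rewrite /K -(cos_kernel_sum (s - (m + l)%:R * d) an) -/d.
pose f k := cos_kernel a (s - (m + l)%:R * d + k%:R * d).
rewrite -!(big_mkord xpredT f) (big_cat_nat (leq0n _) m3n) /=.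
rewrite -addrA gerDl subr_le0 (@le_trans _ _ (\sum_(3 * m <= i < n) tau)) //.
  rewrite !big_nat; apply: ler_sum => i hi; rewrite /f.
  have -> : s - (m + l)%:R * d + i%:R * d = s + i%:R * d - (m + l)%:R * d by ring.
  by apply: tau_ge; apply: in_away => //; rewrite mul2n -addnn ltn_add2l.
by rewrite sumr_const_nat -[tau *+ _]mulr_natl ler_wpM2r // ler_nat leq_subr.
Qed.

Let diff_away (i l : nat) s : `|s| <= b0 -> (i < 3 * m)%N -> (l < 3 * m)%N ->
  b0 <= pi + s + i%:R * d - l%:R * d <= pi *+ 2 - b0.
Proof.
rewrite ler_norml => /andP[s1 s2] hi hl.
have h1 : i%:R * d <= (3 * m)%:R * d by rewrite ler_wpM2r ?(ltW d0) // ler_nat ltnW.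
have h2 : l%:R * d <= (3 * m)%:R * d by rewrite ler_wpM2r ?(ltW d0) // ler_nat ltnW.
have h3 : 0 <= l%:R * d by rewrite mulr_ge0 ?(ltW d0).
have h4 : 0 <= i%:R * d by rewrite mulr_ge0 ?(ltW d0).
move: h1 h2 md b8; rewrite natrM -!mulrA !mulr2n.
by move: (i%:R * d) (l%:R * d) (m%:R * d) h3 h4 s1 s2 => *; apply/andP; split; lra.
Qed.

(** Near [pi] both cross-correlations are [m K] up to kernel tails, while the two
    autocorrelations consist of tails only. The factor
    [((1 + cos b0) / 2) ^ a] is the ratio of the kernel at [b0] to its
    maximum [4 ^ a]. *)
Lemma bumpfun_flat s : `|s| <= b0 ->
  bumpfun (pi + s) + 1 <= 4 * n%:R * ((1 + cos b0) / 2) ^+ a.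
Proof.
move=> hs; rewrite /bumpfun S_blocks.
have hAA : AA (pi + s) <= (3 * m)%:R * ((3 * m)%:R * tau).
  by do 2!(apply: le_card => ?); apply: tau_ge; apply: diff_away.
have hBB : BB (pi + s) <= m%:R * (m%:R * tau).
  do 2!(apply: le_card => ?); apply: tau_ge.
  by apply: diff_away => //; rewrite mulSn ltn_add2l (leq_trans (ltn_ord _)) // leq_pmull.
have hAB : m%:R * (K - n%:R * tau) <= AB (pi + s).
  rewrite /AB mulr_natl -[m in _ *+ m]card_ord -sumr_const; apply: ler_sum => l _.
  have -> : pi + s - pi = s by ring.
  exact: sum_tail.
have hBA : m%:R * (K - n%:R * tau) <= BA (pi + s).
  rewrite /BA mulr_natl -[m in _ *+ m]card_ord -sumr_const; apply: ler_sum => l _.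
  have := @sum_tail (- s) l; rewrite normrN => /(_ hs); congr (_ <= _).
  apply: eq_bigr => i _; rewrite -cos_kernelN -cos_kernelD2pi; congr cos_kernel.
  rewrite mulr2n; ring.
have nm : 8 * m%:R <= n%:R :> R by rewrite /n natrM ler_wpM2r.
have hS : (AA (pi + s) + BB (pi + s) - AB (pi + s) - BA (pi + s)) / (2 * m%:R * K) + 1
   <= 2 * n%:R * tau / K.
  have -> : 2 * n%:R * tau / K = (4 * m%:R * n%:R * tau) / (2 * m%:R * K).
    by field; rewrite !gt_eqF.
  rewrite -[X in _ + X](@divff _ (2 * m%:R * K)); last by rewrite !mulf_neq0 ?gt_eqF.
  rewrite -mulrDl; apply: ler_wpM2r; first by rewrite invr_ge0 -mulrA mulr_ge0 // ltW.
  have h : (10 * m%:R * m%:R) * tau <= (2 * m%:R * n%:R) * tau.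
    apply: ler_wpM2r => //; have := ler_wpM2l (ltW mR0) nm.
    have := mulr_ge0 (ltW mR0) (ltW mR0).
    by move: (m%:R) (n%:R) => *; lra.
  move: hAA hBB hAB hBA h; rewrite !(natrM _ 3 m).
  move: (AA _) (BB _) (AB _) (BA _) (m%:R) (n%:R) K tau => *; lra.
apply: le_trans hS _.
have hK : 4 ^+ a <= ((a.*2).+1)%:R * 'C(a.*2, a)%:R :> R by exact: central_ge.
have C0 := central_gt0 a.
have -> : tau = ((1 + cos b0) / 2) ^+ a * 4 ^+ a.
  by rewrite -exprMn; congr (_ ^+ a); field.
set r := (_ / 2) ^+ a.
have r0 : 0 <= r by apply: exprn_ge0; have := cos_geN1 b0; lra.
rewrite ler_pdivrMr // /K.
have ha : ((a.*2).+1)%:R <= 2 * n%:R :> R.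
  by rewrite -natrM ler_nat -[in leqRHS](prednK n0) mul2n doubleS.
have : 4 ^+ a <= 2 * n%:R * 'C(a.*2, a)%:R :> R.
  by apply: le_trans hK _; rewrite ler_wpM2r // ltW.
move=> h; have nr : 0 <= 2 * n%:R * r by rewrite !mulr_ge0.
have := ler_wpM2l nr h; lra.
Qed.

End FlatBump.

(** * A polynomial with constant term 1, contracting off an arc *)
Lemma fejer_sumE (A : comNzRingType) (y : A) L :
  (1 - y) ^+ 2 * (\sum_(j < L) (L - j)%:R * y ^+ j) =
  L%:R * (1 - y) - y * (1 - y ^+ L).
Proof.
elim: L => [|L IH]; first by rewrite big_ord0 expr0; ring.
have -> : \sum_(j < L.+1) (L.+1 - j)%:R * y ^+ j =
    \sum_(j < L) (L - j)%:R * y ^+ j + \sum_(j < L.+1) y ^+ j.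
  rewrite [LHS]big_ord_recr [X in _ = _ + X]big_ord_recr /= addrA -big_split /=.
  congr (_ + _); last by rewrite subSn // subnn mul1r.
  by apply: eq_bigr => j _; rewrite subSn ?(ltnW (ltn_ord j)) // -natr1; ring.
rewrite mulrDr IH expr2 -mulrA [X in _ + _ * X]mulrDl mul1r.
have -> : \sum_(j < L.+1) y ^+ j + - y * \sum_(j < L.+1) y ^+ j = 1 - y ^+ L.+1.
  by rewrite -{1}[\sum_(j < _) _]mul1r -mulrDl -opprB mulNr -subrX1 opprB.
by rewrite -natr1 exprS; ring.
Qed.

Section Damped.
Context {R : realType}.
Local Notation toC := (real_complex R).
Local Notation normc := (@Normc.normc R).
Local Notation pi := (@trigo.pi R).

Lemma oppr_expi (t : R) : - expi t = expi (t + pi).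
Proof.
rewrite expiD {3}/expi cospi sinpi; apply/eqP; rewrite eq_complex /=.
by apply/andP; split; apply/eqP; ring.
Qed.

Let fs (L : nat) (y : R[i]) : R[i] := \sum_(j < L) (L - j)%:R * y ^+ j.

Let fs_norm L t : normc (fs L (expi t)) <= L%:R ^+ 2.
Proof.
apply: le_trans (normc_sum _ _) _.
apply: (@le_trans _ _ (\sum_(j < L) (L%:R : R))).
  apply: ler_sum => j _; rewrite -expi_mulrn Normc.normcM normc_expi mulr1.
  by rewrite -(rmorph_nat toC) normc_real normr_nat ler_nat leq_subr.
by rewrite sumr_const card_ord -[leLHS]mulr_natl expr2.
Qed.

(** The normalized sum is [1 / (1 - y)] up to [2 / (L |1 - y| ^ 2)], and
    [1 / (1 - y)] has real part 1/2 on the whole circle. *)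
Let fs_Re L t : (0 < L)%N -> cos t < 1 ->
  complex.Re (L%:R^-1 * fs L (expi t)) <= 1 / 2 + 1 / (L%:R * (1 - cos t)).
Proof.
move=> L0 ct; set y := expi t; set u := 1 - y.
have LR : 0 < L%:R :> R by rewrite ltr0n.
have ReuV : complex.Re u^-1 = 1 / 2.
  rewrite /u /y /expi /= sub0r sqrrN sin2cos2.
  have -> : (1 - cos t) ^+ 2 + (1 - cos t ^+ 2) = 2 * (1 - cos t) by ring.
  by field; rewrite gt_eqF // subr_gt0.
have nu : normc u ^+ 2 = 2 * (1 - cos t).
  rewrite sqr_normc /u /y /expi /= sub0r sqrrN sin2cos2; ring.
have u0 : u != 0.
  apply/eqP => h; move: nu; rewrite h Normc.normc0 expr0n /= => e.
  by move: ct e; lra.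
have LC : L%:R != 0 :> R[i] by rewrite pnatr_eq0 -lt0n.
have -> : L%:R^-1 * fs L y = u^-1 - L%:R^-1 * (y * (1 - y ^+ L) * u^-1 ^+ 2).
  apply: (mulfI LC); apply: (mulfI (expf_neq0 2 u0)).
  rewrite [L%:R * (L%:R^-1 * _)]mulrA divff // mul1r fejer_sumE -/u.
  by field; rewrite u0 LC.
rewrite [complex.Re _](_ : _ = complex.Re u^-1 + complex.Re (- (L%:R^-1 * (y * (1 - y ^+ L) * u^-1 ^+ 2)))); last exact: raddfD.
rewrite ReuV lerD2l; apply: le_trans (le_trans (ler_norm _) (normr_Re_le _)) _.
rewrite normcN !Normc.normcM -(rmorph_nat toC) -(fmorphV toC) normc_real.
rewrite normc_expi mul1r normfV normr_nat Normc.normcV.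
have n2 : normc (1 - y ^+ L) <= 2.
  apply: le_trans (le_normcD _ _) _; rewrite normcN -expi_mulrn normc_expi.
  by rewrite Normc.normc1.
have -> : 1 / (L%:R * (1 - cos t)) = L%:R^-1 * (2 * ((normc u)^-1 * (normc u)^-1)).
  by rewrite -invfM -expr2 nu; field; rewrite gt_eqF ?gt_eqF ?subr_gt0.
rewrite ler_pM2l ?invr_gt0 // ler_wpM2r // mulr_ge0 // invr_ge0 normc_ge0 //.
Qed.

(** With [y = - expi t], this is [1 + q / (4 (L + 1) ^ 2)] for
    [q = sum_(0 < j < L) (1 - j / L) y ^ j]. The real part of [q] is
    close to -1/2 away from [y = 1], so to first order the modulus drops below 1
    there; the denominator makes the second-order term negligible since
    [`|q| <= L + 1]. *)
Definition damped (L : nat) : {poly R} :=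
  1 + (4 * (L.+1)%:R ^+ 2)^-1 *:
     (L%:R^-1 *: (\poly_(j < L) ((L - j)%:R * (-1) ^+ j)) - 1).

Lemma damped0 L : (0 < L)%N -> (damped L)`_0 = 1.
Proof.
move=> L0; rewrite /damped coefD coefZ coefB coefZ !coef1 coef_poly L0 subn0 expr0.
by rewrite mulr1 mulVf ?pnatr_eq0 -?lt0n // subrr mulr0 addr0.
Qed.

Let dampedE L t : (map_poly toC (damped L)).[expi t] =
  1 + toC ((4 * (L.+1)%:R ^+ 2)^-1) * (L%:R^-1 * fs L (expi (t + pi)) - 1).
Proof.
rewrite -oppr_expi /damped rmorphD /= map_polyZ rmorphB /= map_polyZ rmorph1.
rewrite !hornerE /=; congr (1 + _ * (_ * _ - 1)).
  by rewrite fmorphV rmorph_nat.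
rewrite (@horner_coef_wide _ L); last first.
  by rewrite (leq_trans (size_poly _ _)) ?size_poly.
apply: eq_bigr => j _.
rewrite (_ : (map_poly _ _)`_j = toC ((L - j)%:R * (-1) ^+ j)); last first.
  by rewrite coef_map coef_poly ltn_ord.
rewrite (rmorphM toC) (rmorph_nat toC) -mulrA; congr (_ * _).
by rewrite -[- expi t]mulN1r exprMn (rmorphXn toC) (rmorphN1 toC).
Qed.

(** On [1 + cos t >= c0], a choice of [L] above [4 / c0] puts the real part
    of [q] below -1/4. Then the squared modulus is at most
    [1 - 1 / (2 s) + 1 / (4 s)] with [s = 4 (L + 1) ^ 2]. *)
Lemma damped_bounds (c0 : R) : 0 < c0 -> exists L : nat, exists rho : R,
  [/\ (0 < L)%N, 0 <= rho < 1, (forall t, normc (map_poly toC (damped L)).[expi t] <= 2)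
    & forall t, c0 <= 1 + cos t -> normc (map_poly toC (damped L)).[expi t] <= rho].
Proof.
move=> c00; pose L := (Num.truncn (4 / c0)).+1.
have LR : 0 < L%:R :> R by rewrite ltr0n.
have hL : 4 / c0 < L%:R by apply: truncnS_gt.
pose s : R := 4 * (L.+1)%:R ^+ 2.
have A1 : 1 <= (L.+1)%:R :> R by rewrite (ler_nat R 1).
have s4 : 4 <= s by rewrite /s; nra.
exists L, (Num.sqrt (1 - 1 / (4 * s))).
pose q t : R[i] := L%:R^-1 * fs L (expi (t + pi)) - 1.
have qn t : normc (q t) <= (L.+1)%:R.
  apply: le_trans (le_normcD _ _) _; rewrite normcN Normc.normc1 -natr1 lerD2r.
  rewrite Normc.normcM -(rmorph_nat toC) -(fmorphV toC) normc_real.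
  by rewrite normfV normr_nat ler_pdivrMl // -expr2 fs_norm.
have E t : normc (map_poly toC (damped L)).[expi t] ^+ 2 =
    1 + 2 * complex.Re (q t) / s + normc (q t) ^+ 2 / s ^+ 2.
  rewrite dampedE -/(q t) -/s !sqr_normc; case: (q t) => a b /=.
  by rewrite !mul0r subr0 addr0 add0r; field; rewrite gt_eqF //; lra.
have s0 : 0 < s by lra.
have h14 : 1 / (4 * s) <= 1 / 16 by rewrite !mul1r lef_pV2 ?posrE; lra.
have h140 : 0 < 1 / (4 * s) by rewrite mul1r invr_gt0; lra.
have qs t : normc (q t) ^+ 2 / s ^+ 2 <= 1 / (4 * s).
  have -> : 1 / (4 * s) = (L.+1)%:R ^+ 2 / s ^+ 2.
    by rewrite /s; field; rewrite gt_eqF //; lra.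
  by rewrite ler_wpM2r ?invr_ge0 ?sqr_ge0 // lerXn2r ?nnegrE ?normc_ge0.
split=> // [|t|t ht].
- rewrite sqrtr_ge0 /= -[X in _ < X]sqrtr1 ltr_sqrt //; lra.
- rewrite -ler_sqr ?nnegrE ?normc_ge0 // E.
  have : 2 * complex.Re (q t) / s <= 1 / 2.
    rewrite ler_pdivrMr //; have := le_trans (le_trans (ler_norm _) (normr_Re_le _)) (qn t); rewrite /s; nra.
  have := qs t; lra.
- rewrite -ler_sqr ?nnegrE ?normc_ge0 ?sqrtr_ge0 //.
  rewrite sqr_sqrtr; last lra.
  rewrite E; suff : 2 * complex.Re (q t) / s <= - (1 / (2 * s)).
    have -> : 1 / (2 * s) = 2 * (1 / (4 * s)) by field; lra.
    have := qs t; lra.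
  have ct : cos (t + pi) = - cos t by rewrite cosDpi.
  have := @fs_Re L (t + pi) isT; rewrite ct opprK => /(_ _) h.
  have {}h : complex.Re (L%:R^-1 * fs L (expi (t + pi))) <= 1 / 2 + 1 / (L%:R * (1 + cos t)).
    by apply: h; lra.
  have hc : 1 / (L%:R * (1 + cos t)) <= 1 / 4.
    rewrite !mul1r lef_pV2 ?posrE ?mulr_gt0 //; last lra.
    rewrite ltr_pdivrMr // in hL; apply: le_trans (ltW hL) _.
    by rewrite ler_wpM2l // ltW.
  have -> : complex.Re (q t) = complex.Re (L%:R^-1 * fs L (expi (t + pi))) - 1.
    by rewrite /q raddfB.
  have -> : - (1 / (2 * s)) = - (1 / 2) / s by field; lra.
  by rewrite ler_wpM2r ?invr_ge0 ?(ltW s0) //; lra.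
Qed.

End Damped.

(** * The cancelling pair *)
Section CancellingPair.
Context {R : realType}.
Local Notation toC := (real_complex R).
Local Notation normc := (@Normc.normc R).
Local Notation pi := (@trigo.pi R).

Definition lp_pow (p : R) (P : {poly R}) : R := \sum_(j < size P) `|P`_j| `^ p.

(** Bernoulli's inequality for [1 - x], where [s <= (1 - x) ^ 3], gives
    [s ^ M <= (1 / (M x)) ^ 3]: one power of [M] more than the quadratic
    factor. *)
Lemma sqr_geometric_small (s C e : R) : 0 <= s < 1 -> 0 < e ->
  exists2 M, (0 < M)%N & C * M%:R ^+ 2 * s ^+ M <= e.
Proof.
move=> /andP[s0 s1] e0.
pose x := (1 - s) / 3; have x0 : 0 < x by rewrite /x; lra.
have x1 : x <= 1 by rewrite /x; lra.
have sx : s <= (1 - x) ^+ 3.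
  have -> : s = 1 - 3 * x by rewrite /x; field.
  rewrite !exprS expr0 mulr1; nra.
have bern M : (1 - x) ^+ M * (1 + M%:R * x) <= 1.
  elim: M => [|M IH]; first by rewrite expr0; lra.
  apply: le_trans IH; rewrite exprSr -mulrA ler_wpM2l //.
    by apply: exprn_ge0; lra.
  rewrite -natr1; have xx := mulr_ge0 (ltW x0) (ltW x0).
  have := mulr_ge0 (ler0n R M) xx; rewrite mulrA.
  lra.
have [C0|C0] := leP C 0.
  exists 1%N => //; rewrite expr1n mulr1 expr1.
  by apply: le_trans (ltW e0); rewrite mulr_le0_ge0.
pose M := (Num.truncn (C / (e * x ^+ 3))).+1.
exists M => //.
have M0 : 0 < M%:R :> R by rewrite ltr0n.
have hM : C / (e * x ^+ 3) < M%:R by apply: truncnS_gt.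
have x30 : 0 < x ^+ 3 by apply: exprn_gt0.
rewrite ltr_pdivrMr in hM; last exact: mulr_gt0.
have u0 : 0 <= (1 - x) ^+ M by apply: exprn_ge0; lra.
have hs : s ^+ M <= ((1 - x) ^+ M) ^+ 3.
  by rewrite -exprM mulnC exprM; apply: lerXn2r; rewrite ?nnegrE // exprn_ge0 //; lra.
apply: (@le_trans _ _ (C * M%:R ^+ 2 * ((1 - x) ^+ M) ^+ 3)).
  by rewrite ler_wpM2l // mulr_ge0 ?sqr_ge0 ?ltW.
have h3 : ((1 - x) ^+ M * (M%:R * x)) ^+ 3 <= 1.
  apply: exprn_ile1; [exact: mulr_ge0 u0 (mulr_ge0 (ltW M0) (ltW x0))|].
  by apply: le_trans (bern M); rewrite ler_wpM2l // lerDr.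
rewrite -(ler_pM2l (mulr_gt0 M0 x30)).
have -> : M%:R * x ^+ 3 * (C * M%:R ^+ 2 * ((1 - x) ^+ M) ^+ 3) =
    C * ((1 - x) ^+ M * (M%:R * x)) ^+ 3.
  by move: ((1 - x) ^+ M) => U; ring.
apply: (@le_trans _ _ C); first by rewrite ler_piMr // ltW.
by apply: ltW; rewrite -mulrA [x ^+ 3 * e]mulrC; exact: hM.
Qed.

Lemma l1N (P : {poly R}) : l1 (- P) = l1 P.
Proof.
by rewrite /l1 size_polyN; apply: eq_bigr => j _; rewrite coefN normrN.
Qed.

Lemma size_exp_le_mul (P : {poly R}) k M : (size P <= k.+1)%N -> (size (P ^+ M) <= (k * M).+1)%N.
Proof.
move=> h; apply: leq_trans (size_poly_exp_leq _ _) _.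
by rewrite ltnS leq_mul2r; apply/orP; right; lia.
Qed.

Lemma powR_le_mul (x y B p : R) : 1 < p -> 0 <= x -> x <= y -> y <= B ->
  x `^ p <= y * B `^ (p - 1).
Proof.
move=> p1 x0 xy yB; have [->|xn] := eqVneq x 0.
  by rewrite powR0 ?mulr_ge0 ?powR_ge0 ?(le_trans x0 xy) //; lra.
have -> : x `^ p = x * x `^ (p - 1).
  rewrite -{2}(powRr1 x0) -powRD; last by rewrite xn implybT.
  by congr powR; lra.
apply: ler_pM; rewrite ?powR_ge0 //.
apply: ge0_ler_powR; rewrite ?nnegrE //; first lra.
  exact: le_trans x0 (le_trans xy yB).
exact: le_trans xy yB.
Qed.

Let nat_fact1 (f g l a n : nat) : (f <= l.+1)%N -> (g <= a.+1)%N -> (a <= n)%N ->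
  ((f + g).-1 <= l + n + 1)%N.
Proof. by lia. Qed.

Let nat_fact2 (L q M : nat) : (0 < M)%N ->
  ((L * M + 2 * (q * M) + 1) * (4 * (q * M) + 3) <=
   (L + 2 * q + 1) * (4 * q + 3) * (M * M))%N.
Proof.
move=> M0; have h1 : (L * M + 2 * (q * M) + 1 <= (L + 2 * q + 1) * M)%N by nia.
have h2 : (4 * (q * M) + 3 <= (4 * q + 3) * M)%N by nia.
by have := leq_mul h1 h2; rewrite mulnACA.
Qed.

Let nat_fact3 (Q mu M : nat) : (8 <= Q)%N -> (0 < mu * M)%N ->
  (mu * M <= (Q * (mu * M)).-1)%N.
Proof. by move=> Q8 h; have := leq_mul Q8 (leqnn (mu * M)); lia. Qed.

Let nat_fact4 (a N : nat) : (0 < N)%N -> ((a * N).+1 <= a.+1 * (N * N))%N.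
Proof. by move=> N0; nia. Qed.

(** Bounded total mass and small coefficients give a small l^p norm exactly because
    [p > 1]. *)
Lemma lp_pow_le_mass (p B : R) (H : {poly R}) : 1 < p ->
  (forall j, 0 <= H`_j) -> (forall j, H`_j <= B) -> lp_pow p H <= H.[1] * B `^ (p - 1).
Proof.
move=> p1 H0 HB; rewrite horner_coef mulr_suml; apply: ler_sum => j _.
by rewrite expr1n mulr1 ger0_norm //; exact: powR_le_mul.
Qed.

(** On the circle ['X^a - 4^-1 *: G] has modulus [1 - v t / 4], at most
    [1 - eta / 4] because [v] lies between [eta] and 3. The Neumann series for
    [4^-1 *: G] around ['X^a], truncated at [N] terms, leaves as remainder the
    [N]-th power of this polynomial, which is geometrically small on the circle and
    thus in l^1. *)
Lemma modulated_inverse (G : {poly R}) (a : nat) (eta : R) (v : R -> R) : 0 < eta ->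
  (forall t, eta <= v t <= 3) -> (size G <= (a.*2).+1)%N ->
  (forall t, (map_poly toC G).[expi t] = expi (a%:R * t) * toC (v t)) ->
  forall e, 0 < e -> exists th : {poly R}, exists N, l1 (th * G - 'X^N) <= e.
Proof.
move=> eta0 vb sG GE e e0.
pose X : {poly R} := 'X^a - 4^-1 *: G.
have XE t : (map_poly toC X).[expi t] = expi (a%:R * t) * toC (1 - v t / 4).
  rewrite /X rmorphB /= map_polyXn map_polyZ hornerD hornerN hornerZ hornerXn GE -expi_mulrn.
  have -> : toC (1 - v t / 4) = 1 - toC 4^-1 * toC (v t).
    by rewrite -toCM [4^-1 * _]mulrC -(rmorph1 toC) -(rmorphB toC).
  by rewrite mulrBr mulr1 mulrCA.
have sX : (size X <= (a.*2).+1)%N.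
  rewrite (leq_trans (size_polyD _ _)) // geq_max size_polyXn ltnS -addnn leq_addr /=.
  by rewrite addnn size_polyN (leq_trans (size_scale_leq _ _)).
have eta3 : eta <= 3 by have /andP[] := vb 0; exact: le_trans.
have [N N0 hN] := @sqr_geometric_small (1 - eta / 4) ((a.*2).+1)%:R e ltac:(lra) e0.
exists (4^-1 *: (\sum_(i < N) 'X^a ^+ (N.-1 - i) * X ^+ i)), (a * N)%N.
have -> : 4^-1 *: (\sum_(i < N) 'X^a ^+ (N.-1 - i) * X ^+ i) * G - 'X^(a * N) = - X ^+ N.
  rewrite -scalerAl scalerAr mulrC.
  have -> : 4^-1 *: G = 'X^a - X by rewrite /X opprB addrC subrK.
  by rewrite -subrXX exprM addrAC subrr sub0r.
rewrite l1N; apply: le_trans (l1_le_sup (B := (1 - eta / 4) ^+ N) (size_exp_le_mul N sX) _) _.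
  move=> t ht; rewrite rmorphXn /= horner_exp XE exprMn Normc.normcM.
  rewrite -expi_mulrn normc_expi mul1r -(rmorphXn toC) normc_real normrX.
  apply: lerXn2r; rewrite ?nnegrE //; first lra.
  by have /andP[? ?] := vb t; rewrite ger0_norm; lra.
apply: le_trans hN; apply: ler_wpM2r; first by apply: exprn_ge0; lra.
by rewrite -natrX -natrM ler_nat expnS expn1 nat_fact4.
Qed.

Lemma cos_le_off_pi (b t : R) : 0 <= b <= pi -> 0 <= t <= pi *+ 2 -> b < `|t - pi| ->
  1 - cos b <= 1 + cos t.
Proof.
move=> hb /andP[t0 t2] far.
suff : cos (t - pi) <= cos b.
  by rewrite -[cos (t - pi)](@opprK _) -(cosDpi (t - pi)) subrK; lra.
have [tp|tp] := leP t pi.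
  rewrite -cosN; apply: cos_le_away => //.
  move: far t2; rewrite ler0_norm ?subr_le0 // opprB mulr2n => *.
  by apply/andP; split; lra.
apply: cos_le_away => //.
move: far t2; rewrite gtr0_norm ?subr_gt0 // mulr2n => *.
by apply/andP; split; lra.
Qed.

(** The bound [8 / Q] is that on the coefficients of the bump, and 2 bounds its
    total mass. *)
Lemma inverse_power_small (p del : R) : 1 < p -> 0 < del ->
  exists2 Q : nat, (8 <= Q)%N & 2 * (8 / Q%:R) `^ (p - 1) <= del.
Proof.
move=> p1 del0; pose z : R := (del / 2) `^ (p - 1)^-1.
have z0 : 0 < z by apply: powR_gt0; lra.
exists (maxn 8 (Num.truncn (8 / z)).+1); first by rewrite leq_maxl.
set Q := maxn _ _.
have Qz : 8 / Q%:R <= z.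
  rewrite ler_pdivrMr ?ltr0n ?leq_max // mulrC -ler_pdivrMr //; apply/ltW.
  by apply: lt_le_trans (truncnS_gt _) _; rewrite ler_nat leq_maxr.
apply: (@le_trans _ _ (2 * z `^ (p - 1))).
  by rewrite ler_wpM2l //; apply: ge0_ler_powR; rewrite ?nnegrE ?(ltW z0) //; lra.
by rewrite /z -powRrM mulVf ?powRr1; lra.
Qed.

(** Take [c = 1 - F] with [F] the [M]-th power of the damped polynomial, and
    [G = 'X^a + (1 - eta) *: H] with [H] the bump and [eta = 4 ^ - M],
    so that [c G - G = - F G]. Off the arc [`|t - pi| <= b], [F] is at
    most [rho ^ M] and [G] at most 3. On the arc [F] is at most [2 ^ M], but [G]
    is at most [(4 n + 1) 4 ^ - M]. Both products decay geometrically in [M]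
    while all degrees grow linearly, so the l^1 norm tends to 0. The parameter [Q]
    makes the coefficients of [H] small and is fixed first; it fixes the width
    [b = pi / Q] of the arc, hence [L] and [rho]; [M] comes last. *)
Theorem cancelling_pair (p0 del : R) : 1 < p0 -> 0 < del ->
  exists c G : {poly R}, exists S : nat,
  [/\ c`_0 = 0, forall j, 0 <= (G - 'X^S)`_j, lp_pow p0 (G - 'X^S) <= del,
      l1 (c * G - G) <= del &
      forall e, 0 < e -> exists th : {poly R}, exists N, l1 (th * G - 'X^N) <= e].
Proof.
move=> p01 del0.
have [Q Q8 hQ] := inverse_power_small p01 del0.
have QR : 8 <= Q%:R :> R by rewrite (ler_nat R 8).
have Q0 : 0 < Q%:R :> R by lra.
pose b := pi / Q%:R; have pi0 := @pi_gt0 R.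
have b0 : 0 < b by apply: divr_gt0.
have bpi : b <= pi by rewrite /b ler_pdivrMr // ler_peMr ?(ltW pi0) //; lra.
have cb : cos b < 1 by apply: cos_lt1; rewrite b0 mulr2n /=; lra.
have [L [rho [L0 /andP[rho0 rho1] D2 Dr]]] := @damped_bounds R (1 - cos b) ltac:(lra).
pose r := (1 + cos b) / 2.
have r0 : 0 <= r by have := cos_geN1 b; rewrite /r; lra.
have r1 : r < 1 by rewrite /r; lra.
have [mu mu0 hmu] : exists2 mu, (0 < mu)%N & r ^+ mu <= 1 / 4.
  have [mu mu0 h] := @sqr_geometric_small r 1 (1 / 4) ltac:(lra) ltac:(lra).
  exists mu => //; apply: le_trans h; rewrite mul1r ler_peMl ?exprn_ge0 //.
  by rewrite -natrX (ler_nat R 1) expn_gt0 mu0.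
(* The rates are [rho] off the arc and [2 * 4^-1 = 1/2] on it. *)
pose s := Num.max rho (1 / 2).
have s0 : 0 <= s by rewrite /s le_max rho0.
have s1 : s < 1 by rewrite /s gt_max rho1 /=; lra.
pose q := (Q * mu)%N.
have [M M0 hM] := @sqr_geometric_small s ((L + 2 * q + 1)%:R * (4 * q + 3)%:R) del
   ltac:(lra) del0.
(* [mu] makes the kernel degree [a = Q m - 1] large enough for the tail
   [r ^+ a] to be at most [4 ^ - M]. *)
pose m := (mu * M)%N; have m0 : (0 < m)%N by rewrite muln_gt0 mu0.
pose n := (Q * m)%N; pose a := n.-1.
have n0 : (0 < n)%N by rewrite muln_gt0 m0 andbT (leq_trans _ Q8).
have nq : n = (q * M)%N by rewrite /n /m /q mulnA.
pose H := @bumppoly R Q m; pose h := @bumpfun R Q m.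
have hb t : -1 <= h t <= 2 by exact: bumpfun_bounds.
have hE t : (map_poly toC H).[expi t] = expi (a%:R * t) * toC (h t).
  exact: bumppoly_horner.
have sH : (size H <= (a.*2).+1)%N by exact: size_bumppoly.
have H0 j : 0 <= H`_j by exact: bumppoly_ge0.
have H8 j : H`_j <= 8 / Q%:R by exact: bumppoly_le.
pose eta : R := (1 / 4) ^+ M.
have eta0 : 0 < eta by apply: exprn_gt0; lra.
have eta1 : eta <= 1 by apply: exprn_ile1; lra.
pose G : {poly R} := 'X^a + (1 - eta) *: H.
pose v t := 1 + (1 - eta) * h t.
have vb t : eta <= v t <= 3 by have := hb t; rewrite /v => /andP[? ?]; apply/andP; split; nra.
have GE t : (map_poly toC G).[expi t] = expi (a%:R * t) * toC (v t).
  rewrite /G rmorphD /= map_polyXn map_polyZ hornerD hornerZ hornerXn hE -expi_mulrn.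
  have -> : toC (v t) = 1 + toC (1 - eta) * toC (h t).
    by rewrite -toCM -(rmorph1 toC) -(rmorphD toC).
  by rewrite mulrDr mulr1 mulrCA.
have sG : (size G <= (a.*2).+1)%N.
  rewrite (leq_trans (size_polyD _ _)) // geq_max size_polyXn ltnS -addnn leq_addr /=.
  by rewrite addnn (leq_trans (size_scale_leq _ _)).
have GX : G - 'X^a = (1 - eta) *: H by rewrite /G addrC addKr.
pose F : {poly R} := (@damped R L) ^+ M.
have sF : (size F <= (L * M).+1)%N.
  apply: size_exp_le_mul; rewrite /damped (leq_trans (size_polyD _ _)) // geq_max.
  rewrite size_poly1 ltnS leq0n /= (leq_trans (size_scale_leq _ _)) //.
  rewrite (leq_trans (size_polyD _ _)) // geq_max size_polyN size_poly1 ltnS leq0n andbT.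
  by rewrite (leq_trans (size_scale_leq _ _)) // (leq_trans (size_poly _ _)).
exists (1 - F), G, a; split.
- rewrite coefB coef1 /= -horner_coef0 horner_exp horner_coef0 damped0 //.
  by rewrite expr1n subrr.
- by move=> j; rewrite GX coefZ mulr_ge0 // subr_ge0.
- rewrite GX.
  have h1 : ((1 - eta) *: H).[1] <= 2.
    rewrite hornerZ; have -> : H.[1] = h 0.
      apply: complexI; have := hE 0; rewrite mulr0 expi0 mul1r => <-.
      by rewrite -(rmorph1 toC) horner_map.
    by have /andP[_ h2] := hb 0; apply: le_trans (ler_wpM2l _ h2) _; rewrite ?subr_ge0 //; lra.
  have co0 j : 0 <= ((1 - eta) *: H)`_j by rewrite coefZ mulr_ge0 // subr_ge0.
  have co8 j : ((1 - eta) *: H)`_j <= 8 / Q%:R.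
    by apply: le_trans (H8 j); rewrite coefZ ler_piMl // gerBl ltW.
  apply: le_trans (lp_pow_le_mass p01 co0 co8) _.
  apply: (@le_trans _ _ (2 * (8 / Q%:R) `^ (p0 - 1))); first by rewrite ler_wpM2r // powR_ge0.
  exact: hQ.
- rewrite mulrBl mul1r addrAC subrr sub0r l1N.
  have sFG : (size (F * G)%R <= L * M + 2 * n + 1)%N.
    apply: leq_trans (size_polyMleq _ _) _.
    by apply: nat_fact1 sF sG _; rewrite -mul2n leq_mul2l leq_pred.
  apply: (le_trans (l1_le_sup (B := (4 * n + 3)%:R * s ^+ M) sFG _)); last first.
    apply: le_trans hM; rewrite mulrA.
    apply: ler_wpM2r; first exact: exprn_ge0.
    rewrite -!natrM -natrX -natrM ler_nat nq expnS expn1.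
    exact: nat_fact2.
  move=> t ht; rewrite rmorphM /= hornerM Normc.normcM GE Normc.normcM normc_expi mul1r normc_real.
  have nF : normc (map_poly toC F).[expi t] = normc (map_poly toC (@damped R L)).[expi t] ^+ M.
    by rewrite /F rmorphXn /= horner_exp normcX.
  rewrite nF ger0_norm; last by have /andP[+ _] := vb t; apply: le_trans; exact: ltW.
  have sM0 : 0 <= s ^+ M by exact: exprn_ge0.
  have [near|far] := leP `|t - pi| b.
    have hf := @bumpfun_flat R Q m Q8 m0 (t - pi) near.
    have e : pi + (t - pi) = t by ring.
    rewrite e -/h -/b -/r -/n -/a in hf.
    have ra : r ^+ a <= (1 / 4) ^+ M.
      apply: (@le_trans _ _ ((r ^+ mu) ^+ M)); last first.
        by apply: lerXn2r; rewrite ?nnegrE ?exprn_ge0 //; lra.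
      rewrite -exprM; apply: ler_wiXn2l => //; first exact: ltW.
      exact: nat_fact3.
    have hv : v t <= (4 * n%:R + 1) * (1 / 4) ^+ M.
      rewrite /v -/eta; have /andP[h1 h2] := hb t.
      have : 4 * n%:R * r ^+ a <= 4 * n%:R * eta by rewrite ler_wpM2l // mulr_ge0.
      move: hf h1 eta0 eta1; move: (4 * n%:R) (r ^+ a) => *; nra.
    apply: (@le_trans _ _ (2 ^+ M * ((4 * n%:R + 1) * (1 / 4) ^+ M))).
      apply: ler_pM => //; rewrite ?exprn_ge0 ?normc_ge0 //.
        by have /andP[+ _] := vb t; apply: le_trans; exact: ltW.
      by apply: lerXn2r; rewrite ?nnegrE ?normc_ge0.
    rewrite mulrCA -exprMn (_ : 2 * (1 / 4) = 1 / 2); last by field.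
    have n40 : 0 <= 4 * n%:R + 1 :> R by rewrite addr_ge0 // mulr_ge0.
    have h20 : 0 <= (1 / 2) ^+ M :> R by apply: exprn_ge0; lra.
    apply: ler_pM n40 h20 _ _; first by rewrite natrD natrM lerD2l (ler_nat R 1 3).
    by apply: lerXn2r; rewrite ?nnegrE /s ?le_max ?lexx ?orbT //; lra.
  apply: (@le_trans _ _ (rho ^+ M * 3)).
    apply: ler_pM; rewrite ?exprn_ge0 ?normc_ge0 //.
    - by have /andP[+ _] := vb t; apply: le_trans; exact: ltW.
    - apply: lerXn2r; rewrite ?nnegrE ?normc_ge0 //; apply: Dr.
      by apply: cos_le_off_pi => //; rewrite bpi ltW.
    - by have /andP[] := vb t.
  rewrite mulrC; apply: (ler_pM (ler0n R 3) (exprn_ge0 M rho0)).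
    by rewrite (ler_nat R 3) leq_addl.
  by apply: lerXn2r; rewrite ?nnegrE // /s le_max lexx.
- exact: modulated_inverse eta0 vb sG GE.
Qed.

End CancellingPair.

(** * Seminorms of L^p on real functions *)
Section LpToolkit.
Context {R : realType}.
Local Notation mu := (@lebesgue_measure R).
Implicit Types (p a : R) (f g : R -> R).

Definition pnorm p f : \bar R := 'N[mu]_p%:E [EFin \o f]%E.

Definition shiftf f a : R -> R := fun x => f (x - a).

Lemma measurable_shiftf f a : measurable_fun setT f -> measurable_fun setT (shiftf f a).
Proof.
by move=> mf; apply: (measurableT_comp mf); apply: measurable_funB.
Qed.

Lemma pnorm_ge0 p f : (0 <= pnorm p f)%E.
Proof. exact: Lnorm_ge0. Qed.

Lemma measurable_powf p f : measurable_fun setT f ->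
  measurable_fun setT (fun x => (`|f x| `^ p)%:E).
Proof.
move=> mf; apply/measurable_EFinP; apply: (measurableT_comp (@measurable_powR R p)).
exact: (measurableT_comp (@normr_measurable R setT) mf).
Qed.

Lemma pnormE p f : pnorm p f = ((\int[mu]_x (`|f x| `^ p)%:E) `^ p^-1)%E.
Proof. by rewrite /pnorm unlock. Qed.

Let int_ge0 p f : (0 <= \int[mu]_x (`|f x| `^ p)%:E)%E.
Proof. by apply: integral_ge0 => x _; rewrite lee_fin powR_ge0. Qed.

(** Bounds on the norm are bounds on the integral of the [p]-th power; [b] is a
    finite real, so no integrability has to be known beforehand. *)
Lemma pnorm_leP p f b : 0 < p -> 0 <= b ->
  (pnorm p f <= b%:E)%E <-> (\int[mu]_x (`|f x| `^ p)%:E <= (b `^ p)%:E)%E.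
Proof.
move=> p0 b0; rewrite pnormE; split => h.
  have := gt0_ler_poweR (ltW p0) _ _ h.
  rewrite !in_itv /= !leey !andbT poweR_ge0 lee_fin b0 => /(_ isT isT).
  by rewrite -poweRrM mulVf ?gt_eqF // poweRe1.
have p0' : 0 <= p^-1 by rewrite invr_ge0 ltW.
have := gt0_ler_poweR p0' _ _ h.
rewrite !in_itv /= !leey !andbT int_ge0 lee_fin powR_ge0 => /(_ isT isT).
by rewrite -powRrM mulfV ?gt_eqF // powRr1.
Qed.

Lemma pnorm_zero p f : 0 < p -> (forall x, f x = 0) -> pnorm p f = 0%E.
Proof.
move=> p0 f0; rewrite (_ : f = fun=> 0); last exact/funext.
by rewrite /pnorm Lnorm0 // gt_eqF.
Qed.

Lemma pnorm_triangle p f g : 1 <= p -> measurable_fun setT f -> measurable_fun setT g ->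
  (pnorm p (fun x => f x + g x)%R <= pnorm p f + pnorm p g)%E.
Proof. by move=> p1 mf mg; exact: minkowski_EFin. Qed.

Lemma pnorm_mono p f g : 0 < p -> measurable_fun setT f -> measurable_fun setT g ->
  (forall x, `|f x| <= `|g x|) -> (pnorm p f <= pnorm p g)%E.
Proof.
move=> p0 mf mg fg; rewrite !pnormE.
have h : (\int[mu]_x (`|f x| `^ p)%:E <= \int[mu]_x (`|g x| `^ p)%:E)%E.
  apply: ge0_le_integral => //.
  - exact: measurable_powf.
  - exact: measurable_powf.
  - by move=> x _; rewrite lee_fin ge0_ler_powR ?nnegrE // ltW.
have p0' : 0 <= p^-1 by rewrite invr_ge0 ltW.
by apply: (gt0_ler_poweR p0' _ _ h); rewrite in_itv /= leey andbT int_ge0.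
Qed.

(** Translation invariance follows from uniqueness of the measure that extends the
    length of intervals. *)
Lemma lebesgue_measure_shift a (A : set R) : measurable A ->
  pushforward mu ((fun x => x - a) : _ -> measurableTypeR R) A = mu A.
Proof.
have ms : measurable_fun [set: measurableTypeR R]
    ((fun x => x - a) : _ -> measurableTypeR R).
  by apply: measurable_funB.
pose phi : {mfun measurableTypeR R >-> measurableTypeR R} := HB.pack
  ((fun x => x - a) : measurableTypeR R -> measurableTypeR R)
  (isMeasurableFun.Build _ _ (measurableTypeR R) (measurableTypeR R) _ ms).
move=> mA; apply/esym.
apply: (@lebesgue_measure_unique R (pushforward mu phi)) => // _ [[x y]] _ <-.
rewrite /pushforward.
rewrite [X in _ = mu X](_ : _ = `]x + a, y + a]%classic); last first.
  by apply/seteqP; split => z /=; rewrite !in_itv /= => /andP[? ?]; apply/andP; split; lra.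
rewrite !lebesgue_measure_itv /= !lte_fin ltrD2r; case: ifP => // _.
by congr (_%:E); ring.
Qed.

Lemma ge0_integral_shift (h : R -> \bar R) a : measurable_fun setT h ->
  (forall x, 0 <= h x)%E -> (\int[mu]_x h (x - a)%R = \int[mu]_x h x)%E.
Proof.
move=> mh h0.
pose sh : R -> measurableTypeR R := fun x => x - a.
have ms : measurable_fun [set: measurableTypeR R] sh by apply: measurable_funB.
transitivity (\int[mu]_(x in sh @^-1` setT) (h \o sh) x)%E.
  by rewrite preimage_setT.
rewrite -(ge0_integral_pushforward ms) //=.
by apply: eq_measure_integral => A mA _; exact: lebesgue_measure_shift.
Qed.

Lemma pnorm_shift p f a : measurable_fun setT f -> pnorm p (shiftf f a) = pnorm p f.
Proof.
move=> mf; have := @ge0_integral_shift (fun x : R => (`|f x| `^ p)%:E) a (measurable_powf p mf).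
by rewrite !pnormE => -> // x; rewrite lee_fin powR_ge0.
Qed.

Lemma pnorm_scale p f c : 0 < p -> measurable_fun setT f ->
  pnorm p (fun x => c * f x)%R = (`|c|%:E * pnorm p f)%E.
Proof.
move=> p0 mf; rewrite !pnormE.
under eq_integral => x _ do rewrite normrM powRM // EFinM.
have i0 (x : R) : [set: R] x -> (0 <= (`|f x| `^ p)%:E)%E by rewrite lee_fin powR_ge0.
rewrite (ge0_integralZl_EFin mu measurableT i0 (measurable_powf p mf)) ?powR_ge0 //.
rewrite poweRM ?lee_fin ?powR_ge0 ?int_ge0 //.
by rewrite poweR_EFin -powRrM mulfV ?gt_eqF // powRr1.
Qed.

Lemma pnorm_bounded p f (B u v : R) : 0 < p -> 0 <= B -> u <= v -> measurable_fun setT f ->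
  (forall x, `|f x| <= B) -> (forall x, f x != 0 -> u < x <= v) ->
  (\int[mu]_x (`|f x| `^ p)%:E <= (B `^ p * (v - u))%:E)%E.
Proof.
move=> p0 B0 uv mf fB fs.
have mi : measurable (`]u, v]%classic : set R) by exact: measurable_itv.
apply: (@le_trans _ _ (\int[mu]_x ((B `^ p)%:E * (\1_(`]u, v]%classic : set R) x)%:E))%E).
  apply: ge0_le_integral => //.
  - exact: measurable_powf.
  - by apply: measurable_funeM; apply/measurable_EFinP; exact: measurable_indic.
  - move=> x _; rewrite -EFinM lee_fin indicE.
    have [fx|fx] := eqVneq (f x) 0.
      by rewrite fx normr0 powR0 ?gt_eqF // mulr_ge0 // powR_ge0.
    rewrite mem_set ?mulr1; last by rewrite /= in_itv /=; exact: fs.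
    by rewrite ge0_ler_powR ?nnegrE // ltW.
have m1 : measurable_fun [set: R] (fun x => (\1_(`]u, v]%classic : set R) x)%:E : \bar R).
  by apply/measurable_EFinP; exact: measurable_indic.
have i0 (x : R) : [set: R] x -> (0 <= ((\1_(`]u, v]%classic : set R) x)%:E : \bar R))%E.
  by rewrite lee_fin indicE.
rewrite (ge0_integralZl_EFin mu measurableT i0 m1) ?powR_ge0 //.
have E : mu (`]u, v]%classic : set R) = (v - u)%:E.
  rewrite lebesgue_measure_itv /= lte_fin; case: ifPn => [_|].
    by rewrite -EFinB.
  by rewrite -leNgt => vu; congr (_%:E); apply/eqP; rewrite eq_sym subr_eq0 eq_le vu uv.
by rewrite integral_indic // setIT [X in (_ * X)%E]E -EFinM.
Qed.

Lemma cvg_powR_pos p (u : nat -> R) (l : R) : 0 < l ->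
  u n @[n --> \oo] --> l -> u n `^ p @[n --> \oo] --> l `^ p.
Proof.
move=> l0 ul.
have -> : l `^ p = expR (p * ln l) by rewrite /powR gt_eqF.
have cv : expR (p * ln (u n)) @[n --> \oo] --> expR (p * ln l).
  apply: (@cvg_comp _ _ _ (fun n => p * ln (u n)) expR); last exact: continuous_expR.
  apply: cvgM; first exact: cvg_cst.
  by apply: (@cvg_comp _ _ _ u (@ln R) _ _ _ ul); exact: continuous_ln.
apply: cvg_trans cv; apply: near_eq_cvg.
near=> n; rewrite /powR gt_eqF //.
near: n; exact: (cvgr_gt l ul).
Unshelve. all: by end_near. Qed.

(** Monotone convergence for the [p]-th powers. *)
Lemma pnorm_nondecreasing_lim p (h_ : nat -> R -> R) h b : 0 < p -> 0 <= b ->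
  (forall n, measurable_fun setT (h_ n)) ->
  (forall n x, 0 <= h_ n x) -> (forall x, nondecreasing_seq (h_ ^~ x)) ->
  (forall x, h_ n x @[n --> \oo] --> h x) ->
  (forall n, pnorm p (h_ n) <= b%:E)%E -> (pnorm p h <= b%:E)%E.
Proof.
move=> p0 b0 mh h0 nd cv hb; apply/pnorm_leP => //.
have hn x n : h_ n x <= h x.
  rewrite -(cvg_lim _ (cv x)) //; apply: nondecreasing_cvgn_le => //.
  exact: cvgP (cv x).
have hx0 x : 0 <= h x by exact: le_trans (h0 0%N x) (hn x 0%N).
have pw x : (`|h_ n x| `^ p)%:E @[n --> \oo] --> (`|h x| `^ p)%:E.
  apply: cvg_EFin; first exact: nearW.
  have [e|ne] := eqVneq (h x) 0.
    have z n : h_ n x = 0 by apply/eqP; rewrite eq_le h0 -e hn.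
    by rewrite e; under eq_fun do rewrite /= z; exact: cvg_cst.
  apply: (cvg_powR_pos (u := fun n => `|h_ n x|)); first by rewrite normr_gt0.
  exact: cvg_norm.
have nd' x : {homo (fun n => (`|h_ n x| `^ p)%:E) : n m / (n <= m)%N >-> (n <= m)%E}.
  move=> n m nm; rewrite lee_fin ge0_ler_powR ?nnegrE ?(ltW p0) //.
  by rewrite !ger0_norm //; exact: nd.
have i0 n x : (0 <= (`|h_ n x| `^ p)%:E)%E by rewrite lee_fin powR_ge0.
have cvi := @cvg_monotone_convergence _ _ _ mu setT measurableT
  (fun n x => (`|h_ n x| `^ p)%:E) (fun n => measurable_powf p (mh n))
  (fun n x _ => i0 n x) (fun x _ => nd' x).
rewrite (_ : (\int[mu]_x (`|h x| `^ p)%:E)%E =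
   (\int[mu]_x limn (fun n => (`|h_ n x| `^ p)%:E))%E); last first.
  by apply: eq_integral => x _; rewrite (cvg_lim _ (pw x)).
rewrite -(cvg_lim _ cvi) //; apply: lime_le; first exact: cvgP cvi.
by apply: nearW => n; apply/pnorm_leP.
Qed.

End LpToolkit.

(** * Polynomials in a translation *)
Section TranslationPolynomials.
Context {R : realType}.
Local Notation mu := (@lebesgue_measure R).
Implicit Types (p a D : R) (f g : R -> R) (P Q : {poly R}).

(** The polynomial [P] evaluated at the translation by [D], applied to [f]; products
    of polynomials become compositions ([poly_shiftM]). *)
Definition poly_shift P D f : R -> R := fun x => \sum_(j < size P) P`_j * f (x - j%:R * D).

Lemma poly_shift_wide n P D f x : (size P <= n)%N ->
  poly_shift P D f x = \sum_(j < n) P`_j * f (x - j%:R * D).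
Proof.
move=> sn; rewrite /poly_shift -!(big_mkord xpredT (fun j => P`_j * f (x - j%:R * D))).
have z : \sum_(size P <= j < n) P`_j * f (x - j%:R * D) = 0.
  rewrite big_nat_cond big1 // => j /andP[/andP[h _] _].
  by rewrite nth_default // mul0r.
by rewrite [RHS](big_cat_nat (leq0n _) sn) /= z addr0.
Qed.

Lemma poly_shiftD P Q D f x : poly_shift (P + Q) D f x = poly_shift P D f x + poly_shift Q D f x.
Proof.
rewrite !(@poly_shift_wide (maxn (size P) (size Q))) ?leq_maxl ?leq_maxr ?size_polyD //.
by rewrite -big_split; apply: eq_bigr => j _; rewrite coefD mulrDl.
Qed.

Lemma poly_shiftZ c P D f x : poly_shift (c *: P) D f x = c * poly_shift P D f x.
Proof.
rewrite !(@poly_shift_wide (size P)) ?size_scale_leq // mulr_sumr.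
by apply: eq_bigr => j _; rewrite coefZ mulrA.
Qed.

Lemma poly_shiftB P Q D f x : poly_shift (P - Q) D f x = poly_shift P D f x - poly_shift Q D f x.
Proof. by rewrite poly_shiftD -scaleN1r poly_shiftZ mulN1r. Qed.

Lemma poly_shiftC c D f x : poly_shift c%:P D f x = c * f x.
Proof.
by rewrite (@poly_shift_wide 1) ?size_polyC_leq1 // big_ord1 coefC eqxx mul0r subr0.
Qed.

Lemma poly_shift1 D f x : poly_shift 1 D f x = f x.
Proof. by rewrite -[1]/(1%:P) poly_shiftC mul1r. Qed.

Lemma poly_shiftMX P D f x : poly_shift (P * 'X) D f x = poly_shift P D f (x - D).
Proof.
have s : (size (P * 'X)%R <= (size P).+1)%N.
  by apply: leq_trans (size_polyMleq _ _) _; rewrite size_polyX addn2.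
rewrite (poly_shift_wide D f x s).
rewrite big_ord_recl coefMX eqxx mul0r add0r; apply: eq_bigr => j _.
by rewrite coefMX lift0 /= -natr1; congr (_ * f _); ring.
Qed.

Lemma poly_shiftXn n D f x : poly_shift 'X^n D f x = f (x - n%:R * D).
Proof.
elim: n x => [|n IH] x; first by rewrite expr0 poly_shift1 mul0r subr0.
by rewrite exprSr poly_shiftMX IH -natr1; congr f; ring.
Qed.

Lemma poly_shiftM P Q D f x : poly_shift (P * Q) D f x = poly_shift P D (poly_shift Q D f) x.
Proof.
elim/poly_ind: P x => [|P c IH] x; first by rewrite mul0r /poly_shift size_poly0 !big_ord0.
by rewrite mulrDl -mulrA ['X * _]mulrC mulrA !poly_shiftD !poly_shiftMX IH mul_polyC poly_shiftZ poly_shiftC.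
Qed.

Lemma measurable_poly_shift P D f : measurable_fun setT f -> measurable_fun setT (poly_shift P D f).
Proof.
move=> mf; apply: measurable_sum => j; apply: measurable_funM; first exact: measurable_cst.
exact: (measurable_shiftf (j%:R * D)).
Qed.

Lemma pnorm_sum p (I : Type) (s : seq I) (F : I -> R -> R) : 1 <= p ->
  (forall i, measurable_fun setT (F i)) ->
  (pnorm p (fun x => \sum_(i <- s) F i x)%R <= \sum_(i <- s) pnorm p (F i))%E.
Proof.
move=> p1 mF; elim: s => [|i s IH].
  by rewrite big_nil pnorm_zero //; [lra|move=> x; rewrite big_nil].
rewrite big_cons (_ : (fun x => _) = fun x => F i x + \sum_(j <- s) F j x); last first.
  by apply/funext => x; rewrite big_cons.
apply: le_trans (pnorm_triangle p1 (mF i) _) _; last exact: leeD2l.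
by apply: measurable_sum.
Qed.

Lemma pnorm_poly_shift_l1 P D f p : 1 <= p -> measurable_fun setT f ->
  (pnorm p (poly_shift P D f) <= (l1 P)%:E * pnorm p f)%E.
Proof.
move=> p1 mf; apply: le_trans (pnorm_sum _ p1 _) _.
  move=> j; apply: measurable_funM; first exact: measurable_cst.
  exact: (measurable_shiftf (j%:R * D)).
rewrite /l1 -sumEFin ge0_sume_distrl; last by move=> i _; rewrite lee_fin.
apply: lee_sum => j _; rewrite (pnorm_scale (f := shiftf f (j%:R * D))) ?pnorm_shift //; first lra.
exact: measurable_shiftf.
Qed.

Definition supp_in f (u v : R) := forall x, f x != 0 -> u < x <= v.

(** Supports in a half-open interval of length at most [D] make the shifts by
    multiples of [D] disjoint, even when the length equals [D]. *)
Lemma one_nonzero_shift f u v D x : supp_in f u v -> v - u <= D -> 0 < D ->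
  exists j : nat, forall i : nat, i != j -> f (x - i%:R * D) = 0.
Proof.
move=> hs uvD D0.
have [[j fj]|h] := pselect (exists j : nat, f (x - j%:R * D) != 0); last first.
  exists 0%N => i _; apply/eqP; apply: contrapT => /negP fi; apply: h; by exists i.
exists j => i ij; apply/eqP; apply: contrapT => /negP fi.
have /andP[h1 h2] := hs _ fj; have /andP[h3 h4] := hs _ fi.
have [lij|lji] := ltnP i j.
  have : D <= (j%:R - i%:R) * D.
    by rewrite ler_peMl ?(ltW D0) // -natrB ?(ltnW lij) // (ler_nat R 1) subn_gt0.
  lra.
have {}lji : (j < i)%N by rewrite ltn_neqAle lji eq_sym ij.
have : D <= (i%:R - j%:R) * D.
  by rewrite ler_peMl ?(ltW D0) // -natrB ?(ltnW lji) // (ler_nat R 1) subn_gt0.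
lra.
Qed.

Lemma poly_shift_disj_le P D f u v (d B : R) x : supp_in f u v -> v - u <= D -> 0 < D ->
  0 <= d -> 0 <= B -> (forall j, `|P`_j| <= d) -> (forall x, `|f x| <= B) ->
  `|poly_shift P D f x| <= d * B.
Proof.
move=> hs uv D0 d0 B0 Pd fB; have [j hj] := one_nonzero_shift x hs uv D0.
have [jn|nj] := ltnP j (size P).
  rewrite /poly_shift (bigD1 (Ordinal jn)) //= big1 ?addr0 ?normrM ?ler_pM //.
  by move=> i; rewrite -val_eqE => /= ij; rewrite hj ?mulr0.
rewrite /poly_shift big1 ?normr0 ?mulr_ge0 // => i _; rewrite hj ?mulr0 //.
by rewrite ltn_eqF // (leq_trans (ltn_ord i)).
Qed.

Lemma poly_shift_disj_pow P D f u v p x : 0 < p -> supp_in f u v -> v - u <= D -> 0 < D ->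
  `|poly_shift P D f x| `^ p = \sum_(j < size P) `|P`_j| `^ p * `|f (x - j%:R * D)| `^ p.
Proof.
move=> p0 hs uv D0; have [j hj] := one_nonzero_shift x hs uv D0.
have z (i : nat) : i != j -> `|P`_i| `^ p * `|f (x - i%:R * D)| `^ p = 0.
  by move=> ij; rewrite hj // normr0 powR0 ?gt_eqF // mulr0.
have [jn|nj] := ltnP j (size P).
  rewrite /poly_shift (bigD1 (Ordinal jn)) //= [RHS](bigD1 (Ordinal jn)) //=.
  rewrite big1 ?addr0; last by move=> i; rewrite -val_eqE => /= ij; rewrite hj ?mulr0.
  rewrite big1 ?addr0 ?normrM ?powRM // => i; rewrite -val_eqE => /= ij.
  by rewrite z.
have ne (i : 'I_(size P)) : i != j :> nat by rewrite ltn_eqF // (leq_trans (ltn_ord i)).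
rewrite /poly_shift big1; last by move=> i _; rewrite hj ?mulr0.
by rewrite normr0 powR0 ?gt_eqF // big1 // => i _; rewrite z.
Qed.

(** Disjoint shifts decouple: the [p]-th power of the norm is the l^p power of the
    coefficients times that of [f]. *)
Lemma pnorm_poly_shift_disj P D f u v p (d C : R) : 1 <= p -> measurable_fun setT f ->
  supp_in f u v -> v - u <= D -> 0 < D -> 0 <= d -> 0 <= C ->
  lp_pow p P <= d `^ p -> (pnorm p f <= C%:E)%E -> (pnorm p (poly_shift P D f) <= (d * C)%:E)%E.
Proof.
move=> p1 mf hs uv D0 d0 C0 Pd fC; have p0 : 0 < p by lra.
apply/pnorm_leP => //; first exact: mulr_ge0.
rewrite powRM // EFinM.
under eq_integral => x _ do rewrite (poly_shift_disj_pow _ _ p0 hs uv D0) -sumEFin.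
have m1 (j : 'I_(size P)) : measurable_fun setT
    (fun x : R => (`|P`_j| `^ p * `|f (x - j%:R * D)| `^ p)%:E).
  apply/measurable_EFinP/measurable_funM; first exact: measurable_cst.
  by apply/measurable_EFinP; exact: (measurable_powf p (measurable_shiftf (j%:R * D) mf)).
have i0 (j : 'I_(size P)) (x : R) : [set: R] x ->
    (0 <= (`|P`_j| `^ p * `|f (x - j%:R * D)| `^ p)%:E)%E.
  by rewrite lee_fin mulr_ge0 // powR_ge0.
rewrite (ge0_integral_sum mu measurableT m1 i0).
apply: (@le_trans _ _ (\sum_(j < size P) (`|P`_j| `^ p)%:E * (C `^ p)%:E)%E); last first.
  rewrite -ge0_sume_distrl; last by move=> j _; rewrite lee_fin powR_ge0.
  by rewrite sumEFin -!EFinM lee_fin ler_wpM2r // powR_ge0.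
apply: lee_sum => j _; under eq_integral => x _ do rewrite EFinM.
have i1 (x : R) : [set: R] x -> (0 <= (`|f (x - j%:R * D)| `^ p)%:E)%E.
  by rewrite lee_fin powR_ge0.
have m2 : measurable_fun setT (fun x : R => (`|f (x - j%:R * D)| `^ p)%:E).
  exact: (measurable_powf p (measurable_shiftf (j%:R * D) mf)).
rewrite (ge0_integralZl_EFin mu measurableT i1 m2) ?powR_ge0 //.
apply: lee_wpmul2l; first by rewrite lee_fin powR_ge0.
rewrite (ge0_integral_shift (h := fun x : R => (`|f x| `^ p)%:E)).
- exact/pnorm_leP.
- exact: measurable_powf.
- by move=> x; rewrite lee_fin powR_ge0.
Qed.

(** Scaled by [d], the coefficients are at most 1 in absolute value, so larger
    exponents only decrease the sum. One choice of polynomial for [p0] thus serves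
    all [p >= p0]. *)
Lemma lp_pow_mono p0 p P (d : R) : 0 < p0 -> p0 <= p -> 0 < d ->
  lp_pow p0 P <= d `^ p0 -> (forall j, `|P`_j| <= d) /\ lp_pow p P <= d `^ p.
Proof.
move=> p00 pp d0 h.
have hj j : `|P`_j| <= d.
  have [sj|js] := leqP (size P) j; first by rewrite nth_default // normr0 ltW.
  have : `|P`_j| `^ p0 <= d `^ p0.
    apply: le_trans h; rewrite /lp_pow (bigD1 (Ordinal js)) //= lerDl.
    by apply: sumr_ge0 => *; rewrite powR_ge0.
  apply: contraTT; rewrite -!ltNge => dx.
  by apply: gt0_ltr_powR => //; rewrite nnegrE // ltW.
split => //.
have -> : d `^ p = d `^ p0 * d `^ (p - p0).
  by rewrite -powRD ?(gt_eqF d0) ?implybT //; congr powR; ring.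
apply: le_trans (ler_wpM2r (powR_ge0 _ _) h); rewrite mulr_suml; apply: ler_sum => j _.
have [e|ne] := eqVneq `|P`_j| 0.
  by rewrite e !powR0 ?mul0r //; lra.
have -> : `|P`_j| `^ p = `|P`_j| `^ p0 * `|P`_j| `^ (p - p0).
  by rewrite -powRD ?ne ?implybT //; congr powR; ring.
rewrite ler_wpM2l ?powR_ge0 // ge0_ler_powR ?nnegrE // ?subr_ge0 //; exact: ltW.
Qed.

End TranslationPolynomials.

(** * One stage of the construction *)
Section Stage.
Context {R : realType}.
Implicit Types (p a D : R) (f g : R -> R) (P Q : {poly R}) (l : seq (R * rat)).

Definition ind (a b : R) : R -> R := fun x => ((a < x) && (x <= b))%:R.

Lemma indE a b : ind a b = \1_(`]a, b]%classic : set R).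
Proof. by apply/funext => x; rewrite /ind indicE mem_setE in_itv. Qed.

Lemma measurable_ind a b : measurable_fun setT (ind a b).
Proof. by rewrite indE; exact: measurable_indic. Qed.

Lemma supp_ind a b : supp_in (ind a b) a b.
Proof. by move=> x; rewrite /ind; case: (_ && _) => //; rewrite eqxx. Qed.

Definition box : R -> R := ind 0 1.

(** Only rational translates occur: each stage serves the translates by a single
    point, so the points to be served have to be countably many. *)
Definition rat_comb l f : R -> R := fun x => \sum_(t <- l) t.1 * f (x - ratr t.2).
Definition comb_weight l : R := \sum_(t <- l) `|t.1|.

Lemma measurable_rat_comb l f : measurable_fun setT f -> measurable_fun setT (rat_comb l f).
Proof.
move=> mf; apply: measurable_sum => t; apply: measurable_funM; first exact: measurable_cst.
exact: (measurable_shiftf (ratr t.2)).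
Qed.

Lemma pnorm_rat_comb l f p : 1 <= p -> measurable_fun setT f ->
  (pnorm p (rat_comb l f) <= (comb_weight l)%:E * pnorm p f)%E.
Proof.
move=> p1 mf; apply: le_trans (pnorm_sum _ p1 _) _.
  move=> t; apply: measurable_funM; first exact: measurable_cst.
  exact: (measurable_shiftf (ratr t.2)).
rewrite /comb_weight -sumEFin ge0_sume_distrl; last by move=> i _; rewrite lee_fin.
apply: lee_sum => t _; rewrite (pnorm_scale (f := shiftf f (ratr t.2))) ?pnorm_shift //; first lra.
exact: measurable_shiftf.
Qed.

Definition rat_combM l1 l2 : seq (R * rat) := [seq (s.1 * t.1, s.2 + t.2) | s <- l1, t <- l2].

Lemma rat_comb_combM l1 l2 f x : rat_comb (rat_combM l1 l2) f x = rat_comb l1 (rat_comb l2 f) x.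
Proof.
rewrite /rat_comb /rat_combM big_allpairs_dep /=; apply: eq_bigr => s _.
rewrite mulr_sumr; apply: eq_bigr => t _; rewrite mulrA; congr (_ * f _).
by rewrite rmorphD /=; ring.
Qed.

Lemma poly_shift_rat_comb P (D : nat) (z : rat) f :
  exists l, forall x, poly_shift P D%:R f (x - ratr z) = rat_comb l f x.
Proof.
exists [seq (P`_j, z + (j * D)%:R) | j <- index_iota 0 (size P)] => x.
rewrite /rat_comb big_map /poly_shift big_mkord.
apply: eq_bigr => j _ /=; congr (_ * f _).
by rewrite rmorphD /= ratr_nat natrM; ring.
Qed.

(** This replaces a non-vanishing condition on the Fourier transform of [f] and,
    unlike it, is uniform in [p]: the combination is chosen before the exponent. *)
Definition recovers_box f := forall e, 0 < e -> exists l, forall p, 1 <= p ->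
  (pnorm p (fun x => box x - rat_comb l f x)%R <= e%:E)%E.

Record nice f : Prop := Nice {
  nice_ge0 : forall x, 0 <= f x;
  nice_meas : measurable_fun setT f;
  nice_bnd : exists2 B, 0 <= B & forall x, f x <= B;
  nice_supp : exists2 T, 0 <= T & supp_in f (- T) T;
  nice_recovers_box : recovers_box f }.

Lemma nice_np f : nice f -> exists2 C, 0 <= C & forall p, 1 <= p -> (pnorm p f <= C%:E)%E.
Proof.
move=> [f0 mf [B B0 fB] [T T0 fT] _].
exists (B * (2 * T + 1)) => [|p p1]; first by rewrite mulr_ge0 //; lra.
have p0 : 0 < p by lra.
apply/pnorm_leP => //; first by rewrite mulr_ge0 //; lra.
apply: le_trans (pnorm_bounded (B := B) p0 B0 _ mf _ fT) _; first lra.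
  by move=> x; rewrite ger0_norm.
rewrite powRM //; last lra.
rewrite lee_fin ler_wpM2l ?powR_ge0 //.
apply: (@le_trans _ _ (2 * T + 1)); first lra.
by rewrite -[leLHS]powRr1 ?ler_powR //; lra.
Qed.

Lemma measurable_box : measurable_fun setT box. Proof. exact: measurable_ind. Qed.

Lemma recovers_box_box : recovers_box box.
Proof.
move=> e e0; exists [:: (1, 0)] => p p1.
rewrite pnorm_zero ?lee_fin ?ltW //; first lra.
by move=> x; rewrite /rat_comb big_seq1 /= rmorph0 subr0 mul1r subrr.
Qed.

Lemma nice_box : nice box.
Proof.
split.
- by move=> x; rewrite /box /ind ler0n.
- exact: measurable_box.
- by exists 1 => // x; rewrite /box /ind; case: (_ && _).
- by exists 1 => // x /supp_ind /andP[? ?]; apply/andP; split; lra.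
- exact: recovers_box_box.
Qed.

(** Take [f' (x) = sum_j G_j f (x + S D - j D)] for the cancelling pair.
    The polynomial [c] is chosen before [D], which may be any large natural number;
    natural so that rational translates remain rational. Recovery passes from [f] to
    [f'] through the approximate inverse of [G], whose error is taken small against
    the combination that recovers the box from [f]. *)
Lemma stage_function p0 b f : 1 < p0 -> 0 < b -> nice f ->
  exists2 c : {poly R}, c`_0 = 0 &
  exists D0 : R, forall D : nat, D0 <= D%:R ->
  exists f', [/\ nice f', forall x, f x <= f' x <= f x + b,
    forall p, p0 <= p -> (pnorm p (fun x => f' x - f x)%R <= b%:E)%E &
    forall p, p0 <= p -> (pnorm p (fun x => poly_shift c D%:R f' x - f' x)%R <= b%:E)%E].
Proof.
move=> p01 b0 nf; have [C C0 fC] := nice_np nf.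
have [f0 mf [B B0 fB] [T T0 fT] rf] := nf.
pose d : R := b / (B + C + 1).
have d0 : 0 < d by apply: divr_gt0 => //; lra.
have dB : d * B <= b.
  by rewrite /d mulrAC ler_pdivrMr; [rewrite ler_wpM2l ?ltW //; lra|lra].
have dC : d * C <= b.
  by rewrite /d mulrAC ler_pdivrMr; [rewrite ler_wpM2l ?ltW //; lra|lra].
have del0 : 0 < Num.min (d `^ p0) d by rewrite lt_min d0 powR_gt0.
have [c [G [S [c0 G0 Gp cG inv]]]] := cancelling_pair p01 del0.
exists c => //; exists (2 * T + 1) => D hD.
have D0 : 0 < D%:R :> R by lra.
have TD : T - - T <= D%:R by lra.
set H := G - 'X^S in G0 Gp.
have Gp' : lp_pow p0 H <= d `^ p0 by apply: le_trans Gp _; rewrite ge_min lexx.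
have cG' : l1 (c * G - G) <= d by apply: le_trans cG _; rewrite ge_min lexx orbT.
have Hmono p (pp : p0 <= p) := @lp_pow_mono _ p0 p H d (lt_trans ltr01 p01) pp d0 Gp'.
have Hd j : `|H`_j| <= d by have [] := Hmono p0 (lexx _).
pose y : R := S%:R * D%:R.
pose f' x := poly_shift G D%:R f (x + y).
have f'E x : f' x = f x + poly_shift H D%:R f (x + y).
  rewrite /f' (_ : poly_shift G D%:R f (x + y) = poly_shift ('X^S + H) D%:R f (x + y)).
    by rewrite poly_shiftD poly_shiftXn addrK.
  by congr (poly_shift _ _ _ _); rewrite /H subrKC.
have shE P : (fun x => poly_shift P D%:R f (x + y)) = shiftf (poly_shift P D%:R f) (- y).
  by apply/funext => x; rewrite /shiftf opprK.
have mop P : measurable_fun setT (fun x : R => poly_shift P D%:R f (x + y)).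
  by rewrite shE; apply: measurable_shiftf; exact: measurable_poly_shift.
have H0 x : 0 <= poly_shift H D%:R f x by apply: sumr_ge0 => j _; rewrite mulr_ge0.
have npH p : p0 <= p -> (pnorm p (fun x => poly_shift H D%:R f (x + y)) <= b%:E)%E.
  move=> pp; rewrite shE pnorm_shift; last exact: measurable_poly_shift.
  have [_ hp] := Hmono p pp.
  apply: le_trans (_ : ((d * C)%:E <= b%:E)%E); last by rewrite lee_fin.
  by apply: (pnorm_poly_shift_disj _ _ fT) => //; [lra|exact: ltW|apply: fC; lra].
exists f'; split.
- split.
  + by move=> x; rewrite f'E addr_ge0.
  + exact: mop.
  + exists (B + b) => [|x]; first lra.
    rewrite f'E lerD //; apply: le_trans (ler_norm _) (le_trans _ dB).
    apply: (poly_shift_disj_le (u := - T) (v := T)) => //; first exact: ltW.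
    by move=> z; rewrite ger0_norm.
  + exists (T + (size G)%:R * D%:R + y).
      by rewrite !addr_ge0 // ?mulr_ge0.
    move=> x fx.
    have [j fj] : exists j : 'I_(size G), f (x + y - j%:R * D%:R) != 0.
      apply: contrapT => hn; move: fx; rewrite /f' /poly_shift big1 ?eqxx // => j _.
      have [->|h] := eqVneq (f (x + y - j%:R * D%:R)) 0; first by rewrite mulr0.
      by exfalso; apply: hn; exists j.
    have /andP[h1 h2] := fT _ fj.
    have h3 : j%:R * D%:R <= (size G)%:R * D%:R :> R.
      by rewrite ler_wpM2r // ler_nat ltnW.
    have h4 : 0 <= j%:R * D%:R :> R by rewrite mulr_ge0.
    have h5 : 0 <= y by rewrite mulr_ge0.
    by apply/andP; split; lra.
  + move=> e e0; have [l hl] := rf (e / 2) ltac:(lra).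
    have l0 : 0 <= comb_weight l by apply: sumr_ge0.
    have K0 : 0 < (comb_weight l * C + 1) * 2 by rewrite mulr_gt0 // ltr_wpDl // mulr_ge0.
    have [th [N thN]] := inv (e / ((comb_weight l * C + 1) * 2)) (divr_gt0 e0 K0).
    have [lth hlth] := @poly_shift_rat_comb th D ((S * D)%:R - (N * D)%:R : rat) f'.
    exists (rat_combM l lth) => p p1.
    pose w x := f x - rat_comb lth f' x.
    have wE : w = shiftf (poly_shift (- (th * G - 'X^N)) D%:R f) (- (N%:R * D%:R)).
      apply/funext => x; rewrite /w -hlth /shiftf opprB poly_shiftB poly_shiftXn poly_shiftM opprK addrK.
      congr (_ - _); apply: eq_bigr => j _; congr (_ * _); rewrite /f'.
      by congr poly_shift; rewrite /y rmorphB /= !ratr_nat !natrM; ring.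
    have mw : measurable_fun setT w.
      by rewrite wE; apply: measurable_shiftf; exact: measurable_poly_shift.
    have npw : (pnorm p w <= (e / ((comb_weight l * C + 1) * 2) * C)%:E)%E.
      rewrite wE pnorm_shift; last exact: measurable_poly_shift.
      apply: le_trans (pnorm_poly_shift_l1 _ _ p1 mf) _; rewrite l1N EFinM.
      by apply: lee_pmul; rewrite ?lee_fin ?pnorm_ge0 ?fC // /l1 sumr_ge0.
    rewrite (_ : (fun x => _) = fun x => (box x - rat_comb l f x) + rat_comb l w x); last first.
      apply/funext => x; rewrite rat_comb_combM.
      have -> : rat_comb l w x = rat_comb l f x - rat_comb l (rat_comb lth f') x.
        by rewrite /rat_comb -sumrB; apply: eq_bigr => t _; rewrite -mulrBr.
      by rewrite addrA subrK.
    apply: le_trans (pnorm_triangle p1 _ _) _.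
    * apply: measurable_funB; [exact: measurable_box|exact: measurable_rat_comb].
    * exact: measurable_rat_comb.
    have -> : (e%:E = (e / 2)%:E + (e / 2)%:E)%E by rewrite -EFinD; congr (_%:E); field.
    apply: leeD; first exact: hl.
    apply: le_trans (pnorm_rat_comb _ p1 mw) _.
    apply: (@le_trans _ _ ((comb_weight l)%:E * (e / ((comb_weight l * C + 1) * 2) * C)%:E)%E).
      by apply: lee_wpmul2l; rewrite ?lee_fin.
    rewrite -EFinM lee_fin.
    have -> : comb_weight l * (e / ((comb_weight l * C + 1) * 2) * C) =
      (e / 2) * ((comb_weight l * C) / (comb_weight l * C + 1)).
      field; apply/eqP => h; have := mulr_ge0 l0 C0; lra.
    apply: ler_piMr; first lra.
    by have := mulr_ge0 l0 C0 => ?; rewrite ler_pdivrMr; lra.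
- move=> x; rewrite f'E lerDl H0 /= lerD2l.
  apply: le_trans (ler_norm _) (le_trans _ dB).
  apply: (poly_shift_disj_le (u := - T) (v := T)) => //; first exact: ltW.
  by move=> z; rewrite ger0_norm.
- move=> p pp; rewrite (_ : (fun x => _) = (fun x => poly_shift H D%:R f (x + y))); first exact: npH.
  by apply/funext => x; rewrite f'E addrC addKr.
- move=> p pp; have p1 : 1 <= p by lra.
  rewrite (_ : (fun x => _) = shiftf (poly_shift (c * G - G) D%:R f) (- y)); last first.
    apply/funext => x; rewrite /shiftf opprK poly_shiftB poly_shiftM /f'; congr (_ - _).
    by apply: eq_bigr => j _; congr (_ * poly_shift _ _ _ _); ring.
  rewrite pnorm_shift; last exact: measurable_poly_shift.
  apply: le_trans (pnorm_poly_shift_l1 _ _ p1 mf) _.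
  apply: (@le_trans _ _ (d%:E * C%:E)%E); last by rewrite -EFinM lee_fin.
  by apply: lee_pmul; rewrite ?lee_fin ?pnorm_ge0 ?fC // /l1 sumr_ge0.
Qed.

End Stage.

(** * Sparse sequences containing blocks *)
Section SparseSequences.
Context {R : realType}.
Variable eps : nat -> R.
Hypothesis eps_gt0 : forall n, 0 < eps n.
Hypothesis eps_cvg0 : eps n @[n --> \oo] --> (0 : R).

(** The finite prefixes of the sequence to be built. *)
Definition sparse (s : seq R) :=
  [/\ (0 < size s)%N, forall i, (i < size s)%N -> 0 < s`_i &
      forall i, (i.+1 < size s)%N -> (1 + eps i) * s`_i < s`_i.+1].

Lemma sparse_rcons s x : sparse s -> (1 + eps (size s).-1) * s`_(size s).-1 < x ->
  sparse (rcons s x).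
Proof.
move=> [s0 sp sr] hx; have x0 : 0 < x.
  apply: le_lt_trans hx; apply: mulr_ge0; first by have := eps_gt0 (size s).-1; lra.
  by apply: ltW; apply: sp; rewrite prednK.
split; rewrite ?size_rcons //.
  move=> i; rewrite ltnS leq_eqVlt nth_rcons => /orP[/eqP ->|h].
    by rewrite ltnn eqxx.
  by rewrite h sp.
move=> i; rewrite ltnS leq_eqVlt !nth_rcons => /orP[/eqP h|h].
  by rewrite h ltnn eqxx -h ltnSn; move: hx; rewrite -h.
by rewrite h (ltnW h) sr.
Qed.

Lemma sparse_pad s K : sparse s -> exists t, sparse (s ++ t) /\ (K <= size (s ++ t))%N.
Proof.
move=> gs; elim: K => [|K [t [gt Kt]]]; first by exists [::]; rewrite cats0.
pose x := (1 + eps (size (s ++ t)).-1) * (s ++ t)`_(size (s ++ t)).-1 + 1.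
exists (rcons t x); rewrite -rcons_cat size_rcons; split => //.
by apply: sparse_rcons => //; rewrite /x; lra.
Qed.

(** Inside the block the ratio of the points of indices [j] and [j + 1] is nearly
    [1 + 1 / j >= 1 + 1 / N], and [eps <= 1 / (2 N)] leaves room for
    the shift by [a] when [D] is large. *)
Lemma sparse_block s (a : R) N : sparse s ->
  (forall n, (size s <= n)%N -> eps n * (2 * N%:R) <= 1) ->
  exists D0 : R, forall D, D0 <= D -> sparse (s ++ [seq a + i%:R * D | i <- iota 1 N]).
Proof.
move=> gs hN; pose y := (1 + eps (size s).-1) * s`_(size s).-1.
exists (`|y| + `|a| + 1) => D hD.
have ya := ler_norm y; have aa := ler_norm a; have na := ler_norm (- a).
rewrite normrN in na; have a0 := normr_ge0 a; have y0 := normr_ge0 y.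
suff h j : (j <= N)%N -> sparse (s ++ [seq a + i%:R * D | i <- iota 1 j]) by exact: h.
elim: j => [_|j IH jN]; first by rewrite cats0.
rewrite -[j.+1]addn1 iotaD map_cat /= catA cats1; apply: sparse_rcons; first exact: IH (ltnW jN).
rewrite size_cat size_map size_iota add1n.
case: j jN {IH} => [|j] jN; first by rewrite /= addn0 cats0 mul1r -/y; lra.
rewrite addnS -[(_.+1).-1]/(size s + j)%N nth_cat ifN -?leqNgt ?leq_addr // addKn.
rewrite (nth_map 0%N) ?size_iota // nth_iota // add1n.
have he := eps_gt0 (size s + j); have hn := hN (size s + j)%N (leq_addr _ _).
have jR : j.+1%:R <= N%:R :> R by rewrite ler_nat ltnW.
have N2 : 2 <= N%:R :> R by rewrite (ler_nat R 2) (leq_trans _ jN).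
set e := eps _ in he hn *; set u : R := j.+1%:R in jR *.
have D1 : 1 <= D by lra.
have h1 : e * u * D <= D / 2.
  have : e * u <= 1 / 2 by have := ler_wpM2l (ltW he) jR; lra.
  by move=> h; have := ler_wpM2r (ltW (lt_le_trans ltr01 D1)) h; lra.
have e1 : e <= 1 / 4 by have := ler_wpM2l (ltW he) N2; lra.
have h2 : e * a <= `|a| / 4.
  apply: le_trans (ler_wpM2l (ltW he) aa) _.
  by have := ler_wpM2r a0 e1; lra.
rewrite -natr1 -/u; lra.
Qed.

Lemma eps_small (c : R) : 0 < c -> exists K, forall n, (K <= n)%N -> eps n <= c.
Proof.
move=> c0; have := cvgr_lt _ eps_cvg0 _ c0 => -[K _ hK].
by exists K => n Kn; apply: ltW; exact: (hK n).
Qed.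

(** The 2-adic valuation takes each value infinitely often, hence each rational is
    met infinitely often. *)
Definition rat_enum (k : nat) : rat := odflt 0 (unpickle (logn 2 k.+1)).

Lemma rat_enum_often q M : exists2 k, (M <= k)%N & rat_enum k = q.
Proof.
pose v := pickle q; exists (2 ^ v * (2 * M).+1).-1%N.
  have : (0 < 2 ^ v)%N by rewrite expn_gt0.
  by move: (2 ^ v)%N => z; nia.
rewrite /rat_enum prednK ?muln_gt0 ?expn_gt0 // lognM ?expn_gt0 // pfactorK //.
have -> : logn 2 (2 * M).+1 = 0%N by rewrite lognE dvdn2 oddS mul2n odd_double !andbF.
by rewrite addn0 pickleK.
Qed.

End SparseSequences.

(** * The sequence of stages *)
Section Construction.
Context {R : realType}.
Variable eps : nat -> R.
Hypothesis eps_gt0 : forall n, 0 < eps n.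
Hypothesis eps_cvg0 : eps n @[n --> \oo] --> (0 : R).

(** The exponents decrease to 1, so every [p > 1] is controlled from some stage
    on. *)
Definition stage_exponent (k : nat) : R := 1 + k.+1%:R^-1.

Record state := State { st_seq : seq R; st_fun : R -> R; st_tol : R }.

(** The last condition makes the prefixes eventually reach every index. *)
Definition valid (x : nat * state) :=
  [/\ sparse eps (st_seq x.2), nice (st_fun x.2), 0 < st_tol x.2 & (x.1 < size (st_seq x.2))%N].

Record step (k : nat) (s : seq R) (f : R -> R) (b : R) (s' : seq R) (f' : R -> R) (b' : R)
    (c : {poly R}) (D : nat) (l : seq (R * rat)) : Prop := Step {
  step_c0 : c`_0 = 0;
  step_cat : exists2 t, s' = s ++ t &
    forall i, (0 < i < size c)%N -> ratr (rat_enum k) + i%:R * D%:R \in t;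
  step_le : forall x, f x <= f' x <= f x + b;
  step_np : forall p, stage_exponent k <= p -> (pnorm p (fun x => f' x - f x)%R <= b%:E)%E;
  step_op : forall p, stage_exponent k <= p -> (pnorm p (fun x => poly_shift c D%:R f' x - f' x)%R <= b%:E)%E;
  step_box : forall p, 1 <= p -> (pnorm p (fun x => box x - rat_comb l f' x)%R <= b%:E)%E;
  step_tol : [/\ b' <= b / 2, b' * (1 + l1 c) <= b & b' * comb_weight l <= b] }.

Definition next (x y : nat * state) :=
  y.1 = x.1.+1 /\ exists c D l,
    step x.1 (st_seq x.2) (st_fun x.2) (st_tol x.2)
         (st_seq y.2) (st_fun y.2) (st_tol y.2) c D l.

(** The choices are made in the order [c], padding, [D], [f'], [l], tolerance: the
    padding uses the size of [c], the shift [D] the padded sequence, and the new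
    tolerance the l^1 norms of [c] and [l]. *)
Lemma next_exists x : valid x -> exists y, valid y /\ next x y.
Proof.
case: x => k [s f b] [/= gs nf b0 ks].
have pk1 : 1 < stage_exponent k by rewrite /stage_exponent ltrDl invr_gt0.
have [c c0 [D0 hD0]] := stage_function pk1 b0 nf.
have N0 : 0 < 2 * (size c).+1%:R :> R by rewrite mulr_gt0.
have [K hK] := eps_small eps_cvg0 (divr_gt0 ltr01 N0).
have [t1 [gs1 ht1]] := sparse_pad eps_gt0 (K + k + 2) gs.
have [D1 hD1] : exists D1 : R, forall D, D1 <= D ->
    sparse eps ((s ++ t1) ++ [seq ratr (rat_enum k) + i%:R * D | i <- iota 1 (size c)]).
  apply: sparse_block => // n hn.
  have Kn : (K <= n)%N by apply: leq_trans hn; apply: leq_trans ht1; rewrite -addnA leq_addr.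
  have := hK n Kn; rewrite ler_pdivlMr // => h; apply: le_trans h.
  by apply: ler_wpM2l; [exact: ltW|rewrite ler_wpM2l // ler_nat].
pose D := (Num.truncn (Num.max D0 D1)).+1.
have hD : Num.max D0 D1 <= D%:R by apply: ltW; exact: truncnS_gt.
have hDD0 : D0 <= D%:R by apply: le_trans hD; rewrite le_max lexx.
have hDD1 : D1 <= D%:R by apply: le_trans hD; rewrite le_max lexx orbT.
have [f' [nf' lef npf opf]] := hD0 D hDD0.
have [l hl] := nice_recovers_box nf' b0.
have c10 : 0 <= l1 c by apply: sumr_ge0.
have l10 : 0 <= comb_weight l by apply: sumr_ge0.
pose b' := b / (2 * (1 + l1 c + comb_weight l)).
have d0 : 0 < 2 * (1 + l1 c + comb_weight l) by lra.
have b'0 : 0 < b' by apply: divr_gt0.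
pose t2 := [seq ratr (rat_enum k) + i%:R * D%:R | i <- iota 1 (size c)] : seq R.
exists (k.+1, State ((s ++ t1) ++ t2) f' b'); split.
  split => //=; first exact: hD1.
  rewrite size_cat; apply: leq_trans (leq_addr _ _); apply: leq_trans ht1.
  by rewrite addn2 !ltnS leq_addl.
split => //; exists c, D, l; split => //=.
- exists (t1 ++ t2); first by rewrite catA.
  move=> i /andP[i0 ic]; rewrite mem_cat; apply/orP; right.
  by apply/mapP; exists i => //; rewrite mem_iota i0 add1n ltnS ltnW.
- have bE : b' * (2 * (1 + l1 c + comb_weight l)) = b by rewrite /b' divfK // gt_eqF.
  have h1 := mulr_ge0 (ltW b'0) c10; have h2 := mulr_ge0 (ltW b'0) l10.
  by split; lra.
Qed.

Lemma construction (lambda0 : R) : 0 < lambda0 ->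
  exists (lam : nat -> R) (F : nat -> R -> R) (b : nat -> R),
  exists (c : nat -> {poly R}) (D : nat -> nat) (l : nat -> seq (R * rat)),
  [/\ lam 0%N = lambda0,
      forall n, 0 < lam n /\ (1 + eps n) * lam n < lam n.+1,
      forall k, nice (F k) /\ 0 < b k &
      forall k,
      [/\ (c k)`_0 = 0 /\ (forall i, (0 < i < size (c k))%N ->
             exists n, lam n.+1 = ratr (rat_enum k) + i%:R * (D k)%:R),
          forall x, F k x <= F k.+1 x <= F k x + b k,
          (forall p, stage_exponent k <= p -> (pnorm p (fun x => F k.+1 x - F k x)%R <= (b k)%:E)%E) /\
          (forall p, stage_exponent k <= p ->
             (pnorm p (fun x => poly_shift (c k) (D k)%:R (F k.+1) x - F k.+1 x)%R <= (b k)%:E)%E),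
          forall p, 1 <= p -> (pnorm p (fun x => box x - rat_comb (l k) (F k.+1) x)%R <= (b k)%:E)%E &
          [/\ b k.+1 <= b k / 2, b k.+1 * (1 + l1 (c k)) <= b k & b k.+1 * comb_weight (l k) <= b k]]].
Proof.
move=> lam0.
pose T := {x : nat * state | valid x}.
have v0 : valid (0%N, State [:: lambda0] box 1).
  split => //=; last exact: nice_box.
  by split => // -[].
have tot (x : T) : {y : T | next (sval x) (sval y)}.
  apply: cid; have [y [vy ny]] := next_exists (svalP x).
  by exists (exist _ y vy).
have [u [u0 hu]] := dependent_choice tot (exist _ _ v0).
have uk k : (sval (u k)).1 = k.
  elim: k => [|k IH]; first by rewrite u0.
  by have [-> _] := hu k; rewrite IH.
pose S k := st_seq (sval (u k)).2.
have vS k : valid (sval (u k)) := svalP (u k).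
have /choice[w hw] : forall k, exists w : ({poly R} * nat) * seq (R * rat),
    step k (S k) (st_fun (sval (u k)).2) (st_tol (sval (u k)).2)
      (S k.+1) (st_fun (sval (u k.+1)).2) (st_tol (sval (u k.+1)).2) w.1.1 w.1.2 w.2.
  move=> k; have [_ [c [D [l]]]] := hu k; rewrite uk => h.
  by exists ((c, D), l).
have Ssize k : (k < size (S k))%N by have [_ _ _] := vS k; rewrite uk.
have Scat k d : exists t, S (k + d)%N = S k ++ t.
  elim: d => [|d [t ht]]; first by exists [::]; rewrite addn0 cats0.
  have [t' ht' _] := step_cat (hw (k + d)%N).
  by exists (t ++ t'); rewrite addnS ht' ht catA.
pose lam n := (S n)`_n.
have lamE n k : (n < size (S k))%N -> lam n = (S k)`_n.
  move=> nk; rewrite /lam; have [nlk|/ltnW kln] := leqP n k.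
    by have [t ht] := Scat n (k - n)%N; rewrite subnKC // in ht; rewrite ht nth_cat Ssize.
  by have [t ht] := Scat k (n - k)%N; rewrite subnKC // in ht; rewrite ht nth_cat nk.
exists lam, (fun k => st_fun (sval (u k)).2), (fun k => st_tol (sval (u k)).2).
exists (fun k => (w k).1.1), (fun k => (w k).1.2), (fun k => (w k).2); split.
- by rewrite /lam /S u0.
- move=> n; have [[_ sp sr] _ _ _] := vS n.+1.
  rewrite (lamE n n.+1) ?(lamE n.+1 n.+1) ?Ssize //; last exact: ltnW (Ssize n.+1).
  by split; [apply: sp; exact: ltnW (Ssize n.+1)|apply: sr; exact: Ssize].
- by move=> k; have [_ nk bk _] := vS k.
- move=> k; have hk := hw k; split.
  + split; first exact: step_c0 hk.
    move=> i hi; have [t ht hin] := step_cat hk.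
    have {}hin := hin i hi; set x := ratr _ + _ in hin *.
    have h0 : (0 < size (S k))%N by exact: leq_ltn_trans (Ssize k).
    pose n := (size (S k) + index x t)%N.
    have nsz : (n < size (S k.+1))%N.
      by rewrite [S k.+1]ht size_cat ltn_add2l index_mem.
    exists n.-1; rewrite prednK; last by rewrite addn_gt0 h0.
    rewrite (lamE _ _ nsz) [S k.+1]ht nth_cat ifN -?leqNgt ?leq_addr //.
    by rewrite addKn nth_index.
  + exact: step_le hk.
  + by split; [exact: step_np hk|exact: step_op hk].
  + exact: step_box hk.
  + exact: step_tol hk.
Qed.

End Construction.

(** * Functions approximable by combinations of a sequence *)
Lemma sum_pad (R : pzRingType) (z w : nat -> R) N M : (N <= M)%N ->
  \sum_(k < M) (if (k < N)%N then z k else 0) * w k = \sum_(k < N) z k * w k.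
Proof.
move=> NM; rewrite -(big_mkord xpredT (fun k => (if (k < N)%N then z k else 0) * w k)).
rewrite (big_cat_nat (leq0n _) NM) /= big_mkord [X in _ + X]big_nat_cond.
rewrite [X in _ + X]big1 ?addr0; first by apply: eq_bigr => k _; rewrite ltn_ord.
by move=> k /andP[/andP[Nk _] _]; rewrite ltnNge Nk /= mul0r.
Qed.

Section Closure.
Context {R : realType}.
Local Notation mu := (@lebesgue_measure R).
Variables (p : R) (v : nat -> R -> R).
Hypothesis p1 : 1 < p.
Hypothesis mv : forall k, measurable_fun setT (v k).
Implicit Types (f g h : R -> R).

Let p1' : 1 <= p. Proof. exact: ltW. Qed.
Let p0 : 0 < p. Proof. exact: lt_trans p1. Qed.

(** Membership in the closed linear span of [v], with measurability so that the
    triangle inequality applies. *)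
Definition approx f := measurable_fun setT f /\ forall e : R, 0 < e ->
  exists N (c : nat -> R),
    (pnorm p (fun x => f x - \sum_(k < N) c k * v k x)%R <= e%:E)%E.

Let mlin N (c : nat -> R) : measurable_fun setT (fun x => \sum_(k < N) c k * v k x).
Proof.
by apply: measurable_sum => k; apply: measurable_funM; [exact: measurable_cst|exact: mv].
Qed.

Lemma approx_meas f : approx f -> measurable_fun setT f. Proof. by case. Qed.

Lemma approx_basis k : approx (v k).
Proof.
split=> // e e0; exists k.+1, (fun j => (j == k)%:R).
rewrite pnorm_zero ?lee_fin ?ltW // => x.
rewrite (bigD1 ord_max) //= eqxx mul1r big1 ?addr0 ?subrr // => j.
by rewrite -val_eqE /= => /negbTE ->; rewrite mul0r.
Qed.

Lemma approx_lim f : measurable_fun setT f ->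
  (forall e : R, 0 < e -> exists2 g, approx g & (pnorm p (fun x => f x - g x)%R <= e%:E)%E) ->
  approx f.
Proof.
move=> mf h; split => // e e0; have [g [mg ag] fg] := h (e / 2) ltac:(lra).
have [N [c hc]] := ag (e / 2) ltac:(lra); exists N, c.
rewrite (_ : (fun x => _) = fun x => (f x - g x) + (g x - \sum_(k < N) c k * v k x)); last first.
  by apply/funext => x; rewrite addrA subrK.
apply: le_trans (pnorm_triangle p1' _ _) _; try exact: measurable_funB.
have -> : (e%:E = (e / 2)%:E + (e / 2)%:E)%E by rewrite -EFinD; congr (_%:E); field.
exact: leeD.
Qed.

Lemma approx_add f g : approx f -> approx g -> approx (fun x => f x + g x).
Proof.
move=> [mf af] [mg ag]; split; first exact: measurable_funD.
move=> e e0; have [N [c hc]] := af (e / 2) ltac:(lra).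
have [M [d hd]] := ag (e / 2) ltac:(lra).
pose ext K (z : nat -> R) (k : nat) : R := if (k < K)%N then z k else 0.
exists (maxn N M), (fun k => ext N c k + ext M d k).
rewrite (_ : (fun x => _) = fun x => (f x - \sum_(k < N) c k * v k x) +
                                     (g x - \sum_(k < M) d k * v k x)); last first.
  apply/funext => x; rewrite -(@sum_pad _ c (v ^~ x) N (maxn N M)) ?leq_maxl //.
  rewrite -(@sum_pad _ d (v ^~ x) M (maxn N M)) ?leq_maxr // addrACA -opprD -big_split /=.
  by congr (_ - _); apply: eq_bigr => k _; rewrite mulrDl.
apply: le_trans (pnorm_triangle p1' _ _) _; try exact: measurable_funB.
have -> : (e%:E = (e / 2)%:E + (e / 2)%:E)%E by rewrite -EFinD; congr (_%:E); field.
exact: leeD.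
Qed.

Lemma approx_scale a f : approx f -> approx (fun x => a * f x).
Proof.
move=> [mf af]; split; first by apply: measurable_funM => //; exact: measurable_cst.
move=> e e0; have a1 : 0 < `|a| + 1 by have := normr_ge0 a; lra.
have [N [c hc]] := af (e / (`|a| + 1)) (divr_gt0 e0 a1).
exists N, (fun k => a * c k).
rewrite (_ : (fun x => _) = fun x => a * (f x - \sum_(k < N) c k * v k x)); last first.
  apply/funext => x; rewrite mulrBr mulr_sumr; congr (_ - _).
  by apply: eq_bigr => k _; rewrite mulrA.
rewrite (pnorm_scale _ p0); last exact: measurable_funB.
apply: (@le_trans _ _ (`|a|%:E * (e / (`|a| + 1))%:E)%E).
  by apply: lee_wpmul2l => //; rewrite lee_fin.
rewrite -EFinM lee_fin mulrCA ler_piMr ?(ltW e0) // ler_pdivrMr // mul1r; lra.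
Qed.

Lemma approx0 : approx (fun=> 0).
Proof.
split; first exact: measurable_cst.
move=> e e0; exists 0%N, (fun=> 0); rewrite pnorm_zero ?lee_fin ?ltW // => x.
by rewrite big_ord0 subrr.
Qed.

Lemma approx_eq f g : f =1 g -> approx f -> approx g.
Proof. by move=> /funext ->. Qed.

Lemma approx_sub f g : approx f -> approx g -> approx (fun x => f x - g x).
Proof.
move=> af ag; apply: approx_eq (approx_add af (approx_scale (-1) ag)) => x.
by rewrite mulN1r.
Qed.

Lemma approx_sum (I : eqType) (s : seq I) (F : I -> R -> R) : (forall i, i \in s -> approx (F i)) ->
  approx (fun x => \sum_(i <- s) F i x).
Proof.
elim: s => [|i s IH] h.
  by apply: approx_eq approx0 => x; rewrite big_nil.
apply: approx_eq (approx_add (h i (mem_head _ _)) (IH _)) => [x|j js]; first by rewrite big_cons.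
by apply: h; rewrite in_cons js orbT.
Qed.

Lemma approx_rat_comb l f : (forall q : rat, approx (shiftf f (ratr q))) -> approx (rat_comb l f).
Proof. by move=> h; apply: approx_sum => t _; exact: (approx_scale t.1 (h t.2)). Qed.

(** Dominated convergence for the [p]-th powers, in the form of one good index. *)
Lemma pnorm_dominated (f_ : nat -> R -> R) f g :
  (forall n, measurable_fun setT (f_ n)) -> measurable_fun setT f -> measurable_fun setT g ->
  (forall x, f_ n x @[n --> \oo] --> f x) -> (forall n x, `|f x - f_ n x| <= `|g x|) ->
  (pnorm p g < +oo)%E -> forall e : R, 0 < e -> exists n, (pnorm p (fun x => f x - f_ n x)%R <= e%:E)%E.
Proof.
move=> mf_ mf mg cv dom gfin e e0.
have ig : mu.-integrable setT (fun x => (`|g x| `^ p)%:E).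
  apply/integrableP; split; first exact: measurable_powf.
  have -> : (\int[mu]_x `|(`|g x| `^ p)%:E| = \int[mu]_x (`|g x| `^ p)%:E)%E.
    by apply: eq_integral => x _; rewrite gee0_abs // lee_fin powR_ge0.
  have gp : (0 <= pnorm p g)%E by exact: pnorm_ge0.
  have : (pnorm p g <= (fine (pnorm p g))%:E)%E by rewrite fineK // ge0_fin_numE.
  move=> /(pnorm_leP _ p0 (fine_ge0 gp)) => h; apply: le_lt_trans h _; exact: ltry.
have mF n : measurable_fun setT (fun x => (`|f x - f_ n x| `^ p)%:E).
  by apply: measurable_powf; exact: measurable_funB.
have pw (x : R) : (`|f x - f_ n x| `^ p)%:E @[n --> \oo] --> (0 : R)%:E.
  apply: cvg_EFin; first exact: nearW.
  have c0 : `|f x - f_ n x| @[n --> \oo] --> (0 : R).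
    rewrite -(normr0 R) -[X in `|X|](subrr (f x)); apply: cvg_norm.
    by apply: cvgB; [exact: cvg_cst|exact: cv].
  apply: (squeeze_cvgr (f := fun=> 0) _ _ c0); last exact: cvg_cst.
  near=> n; rewrite powR_ge0 /=.
  have u1 : `|f x - f_ n x| <= 1 by near: n; apply: (cvgr_le _ c0); exact: ltr01.
  have := powR_le_mul p1 (normr_ge0 _) (lexx _) u1.
  by rewrite powR1 mulr1.
have domE : \forall x \ae mu, forall n : nat, [set: R] x ->
    (`|(`|f x - f_ n x| `^ p)%:E| <= (`|g x| `^ p)%:E)%E.
  apply: aeW => x n _; rewrite gee0_abs ?lee_fin ?powR_ge0 //.
  by apply: ge0_ler_powR; rewrite ?nnegrE // ltW.
have pwE : \forall x \ae mu, [set: R] x ->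
    (`|f x - f_ n x| `^ p)%:E @[n --> \oo] --> (cst 0%E x : \bar R).
  by apply: aeW => x _; exact: pw.
have [_ _] := @dominated_convergence _ _ _ mu _ measurableT
  (fun n x => (`|f x - f_ n x| `^ p)%:E) (cst 0%E) (fun x => (`|g x| `^ p)%:E)
  mF (measurable_cst _) pwE ig domE.
rewrite integral0 => cvI; apply: contrapT => hn.
have big n : ((e `^ p)%:E <= \int[mu]_x (`|f x - f_ n x| `^ p)%:E)%E.
  rewrite leNgt; apply/negP => /ltW h; apply: hn; exists n.
  by apply/pnorm_leP => //; exact: ltW.
have hle : ((e `^ p)%:E <= limn (fun n => \int[mu]_x (`|f x - f_ n x| `^ p)%:E))%E.
  by apply: lime_ge; [exact: cvgP cvI|exact: nearW].
by move: hle; rewrite (cvg_lim _ cvI) // lee_fin leNgt powR_gt0.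
Unshelve. all: by end_near. Qed.

End Closure.

(** * From translates of the unit box to all of L^p *)
Section Density.
Context {R : realType}.
Variables (p : R) (v : nat -> R -> R).
Hypothesis p1 : 1 < p.
Hypothesis mv : forall k, measurable_fun setT (v k).
Hypothesis hbox : forall q : rat, approx p v (shiftf box (ratr q)).
Local Notation approx := (approx p v).

Let p1' : 1 <= p. Proof. exact: ltW. Qed.
Let p0 : 0 < p. Proof. exact: lt_trans p1. Qed.

Lemma ind_split (a b c : R) : a <= b -> b <= c -> forall x, ind a b x + ind b c x = ind a c x.
Proof.
move=> ab bc x; rewrite /ind.
by have [?|?] := ltP a x; have [?|?] := leP x b; have [?|?] := leP x c => /=; lra.
Qed.

Lemma pnorm_ind (a b d : R) : a <= b -> 0 <= d -> b - a <= d `^ p -> (pnorm p (ind a b) <= d%:E)%E.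
Proof.
move=> ab d0 h; apply/pnorm_leP => //.
apply: le_trans (pnorm_bounded (B := 1) p0 ler01 ab (measurable_ind a b) _ (@supp_ind _ a b)) _.
  by move=> x; rewrite /ind; case: (_ && _); rewrite ?normr1 ?normr0.
by rewrite powR1 mul1r lee_fin.
Qed.

Let shift_ind (a b h x : R) : ind a b (x - h) = ind (a + h) (b + h) x.
Proof. by rewrite /ind ltrBrDr lerBlDr. Qed.

Let tele (n : nat) : (1 - 'X) * (\sum_(j < n) (n - j)%:R * 'X^j) =
  n%:R - 'X * (\sum_(j < n) 'X^j) :> {poly R}.
Proof.
have X1 : 1 - 'X != 0 :> {poly R} by rewrite -opprB oppr_eq0 polyXsubC_eq0.
apply: (mulfI X1); rewrite mulrA -expr2 fejer_sumE.
have := subrX1 ('X : {poly R}) n => e.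
by rewrite -[1 - 'X^n]opprB e; ring.
Qed.

(** There are [n] coefficients [1 / n]; their l^p power is [n ^ (1 - p)], and
    2 absorbs the size of the polynomial. *)
Lemma lp_pow_average n : (0 < n)%N ->
  lp_pow p (n%:R^-1 *: ('X * \poly_(j < n) 1)) <= 2 * n%:R `^ (1 - p).
Proof.
move=> n1; have n0 : 0 < n%:R :> R by rewrite ltr0n.
set Q : {poly R} := _ *: _; have sQ : (size Q <= n.+1)%N.
  rewrite (leq_trans (size_scale_leq _ _)) // (leq_trans (size_polyMleq _ _)) // size_polyX.
  by rewrite add2n /= ltnS size_poly.
apply: (@le_trans _ _ (\sum_(j < size Q) n%:R^-1 `^ p)).
  apply: ler_sum => j _; apply: ge0_ler_powR; rewrite ?nnegrE ?invr_ge0 ?(ltW p0) //.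
  rewrite coefZ normrM ger0_norm ?invr_ge0 // ler_piMr ?invr_ge0 //.
  rewrite coefXM coef_poly; case: eqP => _; rewrite ?normr0 //.
  by case: ifP => _; rewrite ?normr1 ?normr0.
rewrite sumr_const card_ord -[leLHS]mulr_natl.
have -> : n%:R^-1 `^ p = n%:R `^ (- p) :> R by rewrite -powR_inv1 // -powRrM mulN1r.
have -> : n%:R `^ (1 - p) = n%:R * n%:R `^ (- p) :> R.
  by rewrite powRD ?powRr1 // (gt_eqF n0) implybT.
rewrite mulrA; apply: ler_wpM2r; first exact: powR_ge0.
by rewrite -natrM ler_nat (leq_trans sQ) // mul2n -addnn -addn1 leq_add2l.
Qed.

(** Let [chi] be the indicator of ]0, h]. The difference of the box and its shift by
    [h] is [chi (x) - chi (x - 1)]. A Cesaro sum of the integer shifts of this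
    difference telescopes to [chi] minus the mean of its shifts by 1 to [n], and
    that mean is small in L^p. *)
Lemma approx_ind_short (q h : rat) : 0 < h -> h <= 1 -> approx (ind (ratr q) (ratr q + ratr h)).
Proof.
move=> h0 h1; apply: (approx_lim p1 mv); first exact: measurable_ind.
move=> e e0.
have hR0 : 0 < ratr h :> R by rewrite ltr0q.
have hR1 : ratr h <= 1 :> R by rewrite -(rmorph1 (@ratr R)) ler_rat.
pose z : R := (2 / e `^ p) `^ (p - 1)^-1.
pose n := (Num.truncn z).+1.
have n0 : 0 < n%:R :> R by rewrite ltr0n.
have ep : 0 < e `^ p by apply: powR_gt0.
have hn : 2 * n%:R `^ (1 - p) <= e `^ p.
  have zn : z <= n%:R by apply: ltW; exact: truncnS_gt.
  have : 2 / e `^ p <= n%:R `^ (p - 1).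
    have -> : 2 / e `^ p = z `^ (p - 1).
      by rewrite /z -powRrM mulVf ?powRr1 ?divr_ge0 ?(ltW ep) // gt_eqF // subr_gt0.
    by apply: ge0_ler_powR; rewrite ?nnegrE ?powR_ge0 ?ler0n ?subr_ge0.
  rewrite ler_pdivrMr // => hz.
  have -> : 1 - p = - (p - 1) by lra.
  rewrite powRN.
  by rewrite ler_pdivrMr ?powR_gt0 // mulrC.
pose chi : R -> R := ind 0 (ratr h).
pose f (x : R) := box x - box (x - ratr h).
have fE x : f x = poly_shift (1 - 'X) 1 chi x.
  rewrite poly_shiftB -['X]mul1r poly_shiftMX !poly_shift1.
  rewrite /f /box /chi !shift_ind !add0r -(ind_split (ltW hR0) hR1).
  have h2 : 1 <= 1 + ratr h :> R by rewrite lerDl ltW.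
  by rewrite -(ind_split hR1 h2) [ratr h + 1]addrC; ring.
pose P : {poly R} := n%:R^-1 *: (\sum_(j < n) (n - j)%:R * 'X^j).
pose Q : {poly R} := n%:R^-1 *: ('X * \poly_(j < n) 1).
have PQ : 1 - P * (1 - 'X) = Q.
  rewrite /P -scalerAl mulrC tele /Q scalerBr.
  have -> : n%:R^-1 *: n%:R = 1 :> {poly R}.
    rewrite (_ : n%:R = n%:R *: 1 :> {poly R}); last by rewrite scaler_nat.
    by rewrite scalerA mulVf ?scale1r // gt_eqF.
  rewrite opprB addrC subrK; congr (_ *: ('X * _)).
  by rewrite poly_def; apply: eq_bigr => j _; rewrite scale1r.
have [l hl] := @poly_shift_rat_comb R P 1%N q f.
exists (rat_comb l f).
  apply: approx_rat_comb => // t.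
  have -> : shiftf f (ratr t) = fun x => shiftf box (ratr t) x - shiftf box (ratr (t + h)) x.
    by apply/funext => x; rewrite /shiftf /f rmorphD /=; congr (_ - box _); ring.
  exact: approx_sub.
rewrite (_ : (fun x => _) = shiftf (poly_shift Q 1 chi) (ratr q)); last first.
  apply/funext => x; rewrite -hl /shiftf -PQ poly_shiftB poly_shiftM poly_shift1.
  congr (_ - _); first by rewrite /ind /chi; congr ((nat_of_bool (_ && _))%:R); lra.
  by apply: eq_bigr => j _; rewrite fE.
rewrite pnorm_shift; last by apply: measurable_poly_shift; exact: measurable_ind.
rewrite -[e]mulr1; apply: (pnorm_poly_shift_disj (u := 0) (v := 1)) => //.
- exact: measurable_ind.
- by move=> x /supp_ind /andP[? ?]; apply/andP; split; lra.
- lra.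
- exact: le_trans (lp_pow_average _) hn.
- apply: pnorm_ind => //; first exact: ltW.
  by rewrite powR1 subr0.
Qed.

Lemma approx_ind_rat (q r : rat) : q < r -> approx (ind (ratr q) (ratr r)).
Proof.
suff H k : forall q h : rat, 0 < h -> h <= 2 ^+ k -> approx (ind (ratr q) (ratr q + ratr h)).
  move=> qr; have h0 : 0 < r - q by rewrite subr_gt0.
  have [k hk] : exists k, r - q <= 2 ^+ k.
    exists (Num.truncn (r - q)).+1; apply: ltW.
    apply: lt_le_trans (truncnS_gt _) _; rewrite -natrX ler_nat ltnW // ltn_expl //.
  by have := H k q _ h0 hk; rewrite -rmorphD /= addrC subrK.
elim: k => [|k IH] s h h0; first by rewrite expr0; exact: approx_ind_short.
rewrite exprS => h1.
have h20 : 0 < h / 2 by lra.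
have hk : h / 2 <= 2 ^+ k by lra.
have hR : 0 < ratr (h / 2) :> R by rewrite ltr0q.
have a2 := IH (s + h / 2) _ h20 hk.
apply: approx_eq (approx_add p1 mv (IH s _ h20 hk) a2) => x.
have hh : ratr h = ratr (h / 2) + ratr (h / 2) :> R.
  by rewrite -rmorphD /=; congr ratr; field.
rewrite rmorphD /= ind_split ?hh ?addrA //; lra.
Qed.

Lemma approx_ind (a b : R) : approx (ind a b).
Proof.
have [ba|ab] := leP b a.
  apply: approx_eq (@approx0 R p v p1) => x; rewrite /ind.
  by have [?|?] := ltP a x; have [?|?] := leP x b => //=; lra.
apply: (approx_lim p1 mv); first exact: measurable_ind.
move=> e e0; pose d := (e / 2) `^ p; have d0 : 0 < d by apply: powR_gt0; lra.
have [q] : exists q : rat, (ratr q : R) \in `]a, Num.min (a + d) b[.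
  by apply: rat_in_itvoo; rewrite lt_min ab andbT; lra.
rewrite in_itv /= lt_min => /andP[aq /andP[qd qb]].
have [r] : exists r : rat, (ratr r : R) \in `]b, b + d[ by apply: rat_in_itvoo; lra.
rewrite in_itv /= => /andP[br rd].
exists (ind (ratr q) (ratr r)).
  by apply: approx_ind_rat; rewrite -(ltr_rat R); lra.
rewrite (_ : (fun x => _) = fun x => ind a (ratr q) x + (-1) * ind b (ratr r) x); last first.
  apply/funext => x.
  rewrite -(ind_split (ltW aq) (ltW qb)) -(ind_split (ltW qb) (ltW br)); ring.
apply: le_trans (pnorm_triangle p1' (measurable_ind _ _) _) _.
  by apply: measurable_funM; [exact: measurable_cst|exact: measurable_ind].
rewrite (pnorm_scale _ p0) ?normrN1 ?mul1e; last exact: measurable_ind.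
have -> : (e%:E = (e / 2)%:E + (e / 2)%:E)%E by rewrite -EFinD; congr (_%:E); field.
by apply: leeD; apply: pnorm_ind; rewrite -/d; lra.
Qed.

(** Borel sets cut by a fixed bounded interval form a Dynkin system, and the half-
    open intervals are stable under intersection and generate the Borel sets. *)
Lemma approx_indic (B : R) (A : set R) : 0 <= B -> measurable A ->
  approx (\1_(A `&` `]-B, B]%classic)).
Proof.
move=> B0; pose I : set R := `]-B, B]%classic.
pose P (S : set (measurableTypeR R)) := approx (\1_((S : set R) `&` I)).
have mI (S : set R) : measurable S -> measurable (S `&` I).
  by move=> mS; apply: measurableI => //; exact: measurable_itv.
have PI S S' : S `&` I = S' `&` I -> P S -> P S' by rewrite /P => ->.
have PT : P setT by rewrite /P setTI /I -indE; exact: approx_ind.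
have := @dynkin_induction _ (measurableTypeR R) (@ocitv R) P.
move=> /(_ erefl (@ocitvI R) PT) H mA; apply: H => //.
- move=> _ [[x y] _ <-]; rewrite /P.
  apply: approx_eq (approx_ind (Num.max x (- B)) (Num.min y B)) => t.
  rewrite indE !indicE; congr (nat_of_bool _)%:R.
  apply/idP/idP; rewrite !inE /I /= !in_itv /= gt_max le_min.
    by move=> /andP[/andP[-> ->] /andP[-> ->]].
  by move=> [/andP[-> ->] /andP[-> ->]].
- move=> S mS PS; apply: approx_eq (approx_sub p1 mv PT PS) => t.
  rewrite !indicE setTI !in_setI in_setC.
  by case: (t \in I); case: (t \in S); rewrite /= ?subrr ?subr0.
- move=> F mF tF PF.
  pose U n : set R := \bigcup_(k in [set k | (k < n)%N]) F k.
  have mU n : measurable (U n) by apply: bigcup_measurable => k _; exact: mF.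
  have appU n : approx (\1_(U n `&` I)).
    apply: approx_eq (@approx_sum R p v p1 mv nat (index_iota 0 n)
       (fun k => \1_(F k `&` I)) (fun k _ => PF k)) => t.
    rewrite big_mkord.
    have [[k kn Fk]|hn] := pselect (U n t); last first.
      rewrite indicE memNset ?big1 //; last by case.
      move=> k _; rewrite indicE memNset // => -[Fk _]; apply: hn.
      by exists (k : nat) => //=.
    rewrite (bigD1 (Ordinal kn)) //= big1 ?addr0.
      rewrite !indicE !in_setI; congr (nat_of_bool (_ && _))%:R.
      by rewrite !mem_set //; exists k.
    move=> j jk; rewrite indicE memNset // => -[Fj _].
    have e := tF k j Logic.I Logic.I (ex_intro _ t (conj Fk Fj)).
    by move: jk; rewrite -val_eqE /= e eqxx.
  have mFI : measurable_fun setT (\1_((\bigcup_k F k) `&` I) : R -> R).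
    by apply: measurable_indic; apply: mI; apply: bigcup_measurable => k _; exact: mF.
  apply: (approx_lim p1 mv) => // e e0.
  have [|||n hn] := pnorm_dominated p1 (f_ := fun n => \1_(U n `&` I))
    (fun n => approx_meas (appU n)) mFI (measurable_ind (- B) B) _ _ _ e0.
  + move=> t; apply: cvg_near_cst.
    have [[k _ Fk]|hn] := pselect ((\bigcup_k F k) t).
      exists k.+1 => // n /= kn; rewrite !indicE !in_setI; congr (nat_of_bool (_ && _))%:R.
      by rewrite !mem_set //; exists k.
    apply: nearW => n; rewrite !indicE !in_setI; congr (nat_of_bool (_ && _))%:R.
    by rewrite !memNset // => -[k _ Fk]; apply: hn; exists k.
  + move=> n t; rewrite indE !indicE !in_setI -/I.
    case: (t \in I); rewrite ?andbF ?andbT ?subrr ?normr0 //.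
    by do 2!case: (t \in _); rewrite ?subrr ?subr0 ?sub0r ?normrN ?normr0 ?normr1.
  + apply: le_lt_trans (pnorm_ind (d := 2 * B + 1) _ _ _) (ltry _); try lra.
    rewrite opprK; apply: (@le_trans _ _ ((2 * B + 1) `^ 1)); first by rewrite powRr1; lra.
    by apply: ler_powR p1'; lra.
  by exists (\1_(U n `&` I)).
Qed.

(** Simple functions truncated to growing intervals converge to a nonnegative [f]
    with domination by [f]. *)
Theorem approx_all (f : R -> R) : measurable_fun setT f -> (pnorm p f < +oo)%E -> approx f.
Proof.
have pos (g : R -> R) : (forall x, 0 <= g x) -> measurable_fun setT g -> (pnorm p g < +oo)%E -> approx g.
  move=> g0 mg gfin; apply: (approx_lim p1 mv) => // e e0.
  have mgE : measurable_fun setT (EFin \o g) by apply/measurable_EFinP.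
  pose a n := nnsfun_approx measurableT mgE n.
  pose w n (x : R) : R := a n x * ind (- n%:R) n%:R x.
  have acv x : a n x @[n --> \oo] --> g x.
    have := @cvg_nnsfun_approx _ _ _ _ measurableT _ mgE (fun x _ => g0 x) x Logic.I.
    by move/fine_cvgP => [].
  have ale n x : a n x <= g x.
    rewrite -(cvg_lim _ (acv x)) //; apply: nondecreasing_cvgn_le; last exact: cvgP (acv x).
    by move=> m k mk; have /lefP := @nd_nnsfun_approx _ _ _ _ measurableT _ mgE m k mk.
  have a0 n x : 0 <= a n x by [].
  have appw n : approx (w n).
    pose fr := fset_set (range (a n)).
    pose T (y : R) : R -> R := fun x =>
      y * \1_((a n @^-1` [set y]) `&` `]-n%:R, n%:R]%classic) x.
    have aT y : approx (T y) by apply: (approx_scale p1 mv); exact: approx_indic.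
    have := approx_sum p1 mv (s := finmap.enum_fset fr) (F := T) (fun y _ => aT y).
    apply: approx_eq => x; rewrite /w fimfunE fsbig_finite //= mulr_suml; apply: eq_bigr => y _.
    by rewrite /T -mulrA; congr (_ * _); rewrite indE indicI.
  have wcv x : w n x @[n --> \oo] --> g x.
    apply: cvg_trans (acv x); apply: near_eq_cvg.
    near=> n; rewrite /w /ind (_ : _ && _ = true) ?mulr1 //.
    have xn : `|x| < n%:R.
      by near: n; apply: nbhs_infty_gtr.
    by move: xn; rewrite ltr_norml => /andP[-> /ltW ->].
  have wle n x : `|g x - w n x| <= `|g x|.
    have h : 0 <= w n x <= g x.
      rewrite /w /ind; case: ((_ < x) && (x <= _)) => /=; first by rewrite mulr1 a0 ale.
      by rewrite mulr0 lexx g0.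
    have /andP[h1 h2] := h.
    by rewrite (ger0_norm (g0 x)) ger0_norm ?subr_ge0 // gerBl.
  have [n hn] := pnorm_dominated p1 (fun n => approx_meas (appw n)) mg mg wcv wle gfin e0.
  by exists (w n).
move=> mf ffin.
have mono (g : R -> R) : measurable_fun setT g -> (forall x, `|g x| <= `|f x|) -> (pnorm p g < +oo)%E.
  by move=> mg gf; apply: le_lt_trans (pnorm_mono p0 mg mf gf) ffin.
have mfp : measurable_fun setT (fun x => Num.max (f x) 0).
  by apply: measurable_maxr => //; exact: measurable_cst.
have mfn : measurable_fun setT (fun x => Num.max (- f x) 0).
  by apply: measurable_maxr; [exact: measurableT_comp|exact: measurable_cst].
have ap : approx (fun x => Num.max (f x) 0).
  apply: pos => //; first by move=> x; rewrite le_max lexx orbT.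
  apply: mono => // x; rewrite ger0_norm ?le_max ?lexx ?orbT //.
  by rewrite ge_max ler_norm normr_ge0.
have an : approx (fun x => Num.max (- f x) 0).
  apply: pos => //; first by move=> x; rewrite le_max lexx orbT.
  apply: mono => // x; rewrite ger0_norm ?le_max ?lexx ?orbT //.
  by rewrite ge_max -normrN ler_norm normr_ge0.
apply: approx_eq (approx_sub p1 mv ap an) => x.
have [h|h] := lerP 0 (f x).
  have h' : - f x <= 0 by rewrite oppr_le0.
  by rewrite (max_r h') subr0.
have h' : 0 <= - f x by rewrite oppr_ge0 ltW.
by rewrite (max_l h') sub0r opprK.
Unshelve. all: by end_near. Qed.

End Density.

(** * The limit function *)
Section Limit.
Context {R : realType}.
Variables (F : nat -> R -> R) (b : nat -> R).
Hypothesis niceF : forall k, nice (F k).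
Hypothesis b_gt0 : forall k, 0 < b k.
Hypothesis b_half : forall k, b k.+1 <= b k / 2.
Hypothesis F_step : forall k x, F k x <= F k.+1 x <= F k x + b k.

Definition flim (x : R) : R := limn (F ^~ x).

Lemma b_geometric k n : b (k + n) <= b k / 2 ^+ n.
Proof.
elim: n => [|n IH]; first by rewrite addn0 divr1.
rewrite addnS exprSr invfM mulrA; apply: le_trans (b_half _) _.
by rewrite ler_pM2r ?invr_gt0.
Qed.

Lemma b_small e : 0 < e -> exists K, forall k, (K <= k)%N -> b k <= e.
Proof.
move=> e0; pose n := Num.truncn (b 0%N / e).
exists n.+1 => k nk; apply: le_trans (b_geometric 0 k) _.
have k2 : b 0%N / e <= 2 ^+ k.
  apply: ltW; apply: lt_le_trans (truncnS_gt _) _; rewrite -natrX ler_nat.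
  by apply: leq_trans nk _; exact: ltnW (ltn_expl k (ltnSn 1)).
by rewrite ler_pdivrMr ?exprn_gt0 // mulrC -ler_pdivrMr.
Qed.

Lemma F_mono x : nondecreasing_seq (F ^~ x).
Proof. by apply/nondecreasing_seqP => k; have /andP[] := F_step k x. Qed.

(** The tolerances halve, so [2 b k] bounds their tail; keeping the negative term
    makes the induction go through. *)
Lemma F_le k n x : F (k + n) x <= F k x + 2 * b k - 2 * b (k + n).
Proof.
elim: n => [|n IH]; first by rewrite addn0; lra.
rewrite addnS; have /andP[_ h] := F_step (k + n) x.
have h2 := b_half (k + n); lra.
Qed.

Lemma F_cvg x : F n x @[n --> \oo] --> flim x.
Proof.
apply: nondecreasing_is_cvgn; first exact: F_mono.
exists (F 0%N x + 2 * b 0%N) => _ [n _ <-].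
by have := F_le 0 n x; rewrite add0n; have := b_gt0 n; lra.
Qed.

Lemma measurable_flim : measurable_fun setT flim.
Proof.
apply: (measurable_fun_cvg (h := F)) => [n|x _]; last exact: F_cvg.
exact: nice_meas (niceF n).
Qed.

Lemma flim_ge k x : F k x <= flim x.
Proof.
rewrite /flim; apply: nondecreasing_cvgn_le; first exact: F_mono.
exact: cvgP (@F_cvg x).
Qed.

Lemma flim_ge0 x : 0 <= flim x.
Proof. exact: le_trans (nice_ge0 (niceF 0) x) (flim_ge 0 x). Qed.

Section Exponent.
Variables (p : R) (K : nat).
Hypothesis p1 : 1 < p.
Hypothesis pnorm_step : forall k, (K <= k)%N ->
  (pnorm p (fun x => F k.+1 x - F k x)%R <= (b k)%:E)%E.

Let p1' : 1 <= p. Proof. exact: ltW. Qed.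
Let p0 : 0 < p. Proof. exact: lt_trans p1. Qed.
Let mF k : measurable_fun setT (F k). Proof. exact: nice_meas. Qed.

Lemma pnorm_partial k n : (K <= k)%N ->
  (pnorm p (fun x => F (k + n) x - F k x)%R <= (2 * b k - 2 * b (k + n))%:E)%E.
Proof.
move=> Kk; elim: n => [|n IH].
  by rewrite addn0 subrr pnorm_zero // => x; rewrite subrr.
rewrite (_ : (fun x => _) = fun x =>
  (F (k + n).+1 x - F (k + n) x) + (F (k + n) x - F k x)); last first.
  by apply/funext => x; rewrite addnS addrA subrK.
apply: le_trans (pnorm_triangle p1' _ _) _; try exact: measurable_funB.
apply: le_trans (leeD (pnorm_step (leq_trans Kk (leq_addr _ _))) IH) _.
rewrite -EFinD lee_fin addnS; have := b_half (k + n); lra.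
Qed.

Lemma pnorm_flim_sub k : (K <= k)%N -> (pnorm p (fun x => flim x - F k x)%R <= (2 * b k)%:E)%E.
Proof.
move=> Kk; have bk := b_gt0 k.
apply: (pnorm_nondecreasing_lim (h_ := fun n x => F (k + n) x - F k x)) => //.
- by lra.
- by move=> n; exact: measurable_funB.
- by move=> n x; rewrite subr_ge0; apply: F_mono; exact: leq_addr.
- by move=> x n m nm; rewrite lerD2r; apply: F_mono; rewrite leq_add2l.
- move=> x; apply: cvgB; last exact: cvg_cst.
  have := F_cvg (x := x); rewrite -(cvg_shiftn k); apply: cvg_trans.
  by apply: near_eq_cvg; apply: nearW => n /=; rewrite addnC.
- move=> n; apply: le_trans (pnorm_partial n Kk) _; rewrite lee_fin.
  by have := b_gt0 (k + n); lra.
Qed.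

Lemma pnorm_flim_fin : (pnorm p flim < +oo)%E.
Proof.
have [C C0 hC] := nice_np (niceF K).
rewrite (_ : flim = fun x => (flim x - F K x) + F K x); last first.
  by apply/funext => x; rewrite subrK.
apply: le_lt_trans (pnorm_triangle p1' _ _) _ => //.
  by apply: measurable_funB => //; exact: measurable_flim.
apply: le_lt_trans (leeD (pnorm_flim_sub (leqnn K)) (hC p p1')) _.
by rewrite -EFinD ltry.
Qed.

Section Span.
Variables (c : nat -> {poly R}) (D : nat -> nat) (l : nat -> seq (R * rat)).
Variables (lam : nat -> R).
Hypothesis c0 : forall k, (c k)`_0 = 0.
Hypothesis freq : forall k i, (0 < i < size (c k))%N ->
  exists n, lam n.+1 = ratr (rat_enum k) + i%:R * (D k)%:R.
Hypothesis pnorm_c : forall k, (K <= k)%N ->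
  (pnorm p (fun x => poly_shift (c k) (D k)%:R (F k.+1) x - F k.+1 x)%R <= (b k)%:E)%E.
Hypothesis pnorm_l : forall k,
  (pnorm p (fun x => box x - rat_comb (l k) (F k.+1) x)%R <= (b k)%:E)%E.
Hypothesis b_c : forall k, b k.+1 * (1 + l1 (c k)) <= b k.
Hypothesis b_l : forall k, b k.+1 * comb_weight (l k) <= b k.

Local Notation v := (fun n => shiftf flim (lam n.+1)).

Let mv n : measurable_fun setT (v n).
Proof. by apply: measurable_shiftf; exact: measurable_flim. Qed.

Let mg := measurable_flim.

(** The error splits into [g - F k.+1], the same filtered by [c], and the defect
    of stage [k]. The tolerance [b k.+1] is small against the l^1 norm of [c], so
    the sum is at most [3 b k]. Since every rational is met at arbitrarily late
    stages, this is as small as desired. *)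
Lemma approx_flim q : approx p v (shiftf flim (ratr q)).
Proof.
apply: (approx_lim p1 mv); first exact: measurable_shiftf.
move=> e e0; have [M hM] := b_small (divr_gt0 e0 (ltr0n R 3)).
have [k kM kq] := rat_enum_often q (maxn M K).
have bk := hM k (leq_trans (leq_maxl _ _) kM).
have Kk : (K <= k)%N := leq_trans (leq_maxr _ _) kM.
exists (shiftf (poly_shift (c k) (D k)%:R flim) (ratr q)).
  have as_ : forall i, i \in index_enum 'I_(size (c k)) ->
      approx p v (fun x => (c k)`_i * flim (x - ratr q - i%:R * (D k)%:R)).
    move=> i _; have [i0|i0] := posnP i.
      by rewrite i0 c0; apply: approx_eq (@approx0 _ p v p1) => x; rewrite mul0r.
    have [n hn] := @freq k i ltac:(by rewrite i0 ltn_ord).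
    apply: approx_eq (approx_scale p1 mv (c k)`_i (approx_basis p1 mv n)) => x.
    by rewrite /shiftf hn kq opprD addrA.
  by have := approx_sum p1 mv as_.
have mop f : measurable_fun setT f -> measurable_fun setT (poly_shift (c k) (D k)%:R f).
  exact: measurable_poly_shift.
pose r x := flim x - F k.+1 x.
have mr : measurable_fun setT r by exact: measurable_funB.
pose u x := F k.+1 x - poly_shift (c k) (D k)%:R (F k.+1) x.
have mu : measurable_fun setT u by apply: measurable_funB => //; exact: mop.
have ub : (pnorm p u <= (b k)%:E)%E.
  rewrite (_ : u = fun x => -1 * (poly_shift (c k) (D k)%:R (F k.+1) x - F k.+1 x)); last first.
    by apply/funext => x; rewrite /u mulN1r opprB.
  by rewrite pnorm_scale ?normrN1 ?mul1e ?pnorm_c //; apply: measurable_funB => //; exact: mop.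
have rb : (pnorm p r <= (2 * b k.+1)%:E)%E by apply: pnorm_flim_sub; exact: leqW.
rewrite (_ : (fun x => _) = shiftf (fun x => r x + (u x + (-1) * poly_shift (c k) (D k)%:R r x)) (ratr q));
  last first.
  apply/funext => x; rewrite /shiftf /r /u.
  have -> (f h : R -> R) y : poly_shift (c k) (D k)%:R (fun x => f x - h x) y =
      poly_shift (c k) (D k)%:R f y - poly_shift (c k) (D k)%:R h y.
    by rewrite /poly_shift -sumrB; apply: eq_bigr => i _; rewrite mulrBr.
  by ring.
have mo : measurable_fun setT (fun x => -1 * poly_shift (c k) (D k)%:R r x).
  by apply: measurable_funM; [exact: measurable_cst|exact: mop].
rewrite pnorm_shift; last by do 2!apply: measurable_funD => //.
apply: le_trans (pnorm_triangle p1' mr _) _; first exact: measurable_funD.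
apply: le_trans (leeD rb (le_trans (pnorm_triangle p1' mu mo) (leeD ub (lexx _)))) _.
rewrite pnorm_scale ?normrN1 ?mul1e //; last exact: mop.
have l0 : 0 <= l1 (c k) by apply: sumr_ge0.
have ob := le_trans (pnorm_poly_shift_l1 (c k) (D k)%:R p1' mr) (lee_wpmul2l _ rb).
apply: le_trans (leeD (lexx _) (leeD (lexx _) (ob _))) _; first by rewrite lee_fin.
rewrite -EFinM -!EFinD lee_fin; have := b_c k.
have : 3 * b k <= e by move: bk; lra.
lra.
Qed.

(** The relation recovering the box at stage [k] survives in the limit, as [b k.+1]
    is small against its coefficients. *)
Lemma approx_box q : approx p v (shiftf box (ratr q)).
Proof.
apply: (approx_lim p1 mv); first by apply: measurable_shiftf; exact: measurable_box.
move=> e e0; have [M hM] := b_small (divr_gt0 e0 (ltr0n R 3)).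
pose k := maxn M K; have bk := hM k (leq_maxl _ _).
have Kk : (K <= k)%N := leq_maxr _ _.
exists (shiftf (rat_comb (l k) flim) (ratr q)).
  have -> : shiftf (rat_comb (l k) flim) (ratr q) = rat_comb (l k) (shiftf flim (ratr q)).
    by apply/funext => x; apply: eq_bigr => t _; congr (_ * flim _); ring.
  apply: (approx_rat_comb p1 mv) => s.
  apply: approx_eq (approx_flim (q + s)) => x; rewrite /shiftf rmorphD /=; congr flim; ring.
pose r x := flim x - F k.+1 x.
have mr : measurable_fun setT r by exact: measurable_funB.
pose u x := box x - rat_comb (l k) (F k.+1) x.
have mu : measurable_fun setT u.
  by apply: measurable_funB; [exact: measurable_box|exact: measurable_rat_comb].
have rb : (pnorm p r <= (2 * b k.+1)%:E)%E by apply: pnorm_flim_sub; exact: leqW.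
rewrite (_ : (fun x => _) = shiftf (fun x => u x + (-1) * rat_comb (l k) r x) (ratr q)); last first.
  apply/funext => x; rewrite /shiftf /r /u.
  have -> (f h : R -> R) y : rat_comb (l k) (fun x => f x - h x) y = rat_comb (l k) f y - rat_comb (l k) h y.
    by rewrite /rat_comb -sumrB; apply: eq_bigr => i _; rewrite mulrBr.
  by ring.
have mo : measurable_fun setT (fun x => -1 * rat_comb (l k) r x).
  by apply: measurable_funM; [exact: measurable_cst|exact: measurable_rat_comb].
rewrite pnorm_shift; last exact: measurable_funD.
apply: le_trans (pnorm_triangle p1' mu mo) _.
rewrite pnorm_scale ?normrN1 ?mul1e //; last exact: measurable_rat_comb.
have l0 : 0 <= comb_weight (l k) by apply: sumr_ge0.
have ob := le_trans (pnorm_rat_comb (l k) p1' mr) (lee_wpmul2l _ rb).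
apply: le_trans (leeD (pnorm_l k) (ob _)) _; first by rewrite lee_fin.
rewrite -EFinM -!EFinD lee_fin; have := b_l k.
have : 3 * b k <= e by move: bk; lra.
lra.
Qed.

Lemma approx_Lp f : measurable_fun setT f -> (pnorm p f < +oo)%E -> approx p v f.
Proof. exact: (approx_all p1 mv approx_box). Qed.

End Span.
End Exponent.
End Limit.

(** * Complex-valued functions and conclusion *)
Section Complexification.
Context {R : realType}.
Local Notation Re := (@complex.Re R).
Local Notation Im := (@complex.Im R).
Local Notation normc := (@Normc.normc R).
Implicit Types (p : R) (f : R -> R[i]).

Lemma normcE (z : R[i]) : normc z = Num.sqrt (Re z ^+ 2 + Im z ^+ 2).
Proof. by case: z. Qed.

Lemma normc_le_ReIm (z : R[i]) : normc z <= `|Re z| + `|Im z|.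
Proof.
rewrite -ler_sqr ?nnegrE ?normc_ge0 ?addr_ge0 // sqr_normc sqrrD !real_normK ?num_real //.
by have := mulr_ge0 (normr_ge0 (Re z)) (normr_ge0 (Im z)); rewrite mulr2n; lra.
Qed.

Lemma measurable_normc f : measurable_fun setT (Re \o f) -> measurable_fun setT (Im \o f) ->
  measurable_fun setT (normc \o f).
Proof.
move=> mr mi.
rewrite (_ : normc \o f = fun x => ((Re \o f) x ^+ 2 + (Im \o f) x ^+ 2) `^ 2^-1); last first.
  by apply/funext => x; rewrite /= normcE powR12_sqrt // addr_ge0 ?sqr_ge0.
apply: (measurableT_comp (@measurable_powR R 2^-1)).
by apply: measurable_funD; exact: measurable_funX.
Qed.

Lemma cLnorm_np p f : cLnorm p f = pnorm p (normc \o f).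
Proof. by []. Qed.

Lemma cLnorm_le_ReIm p f : 1 <= p ->
  measurable_fun setT (Re \o f) -> measurable_fun setT (Im \o f) ->
  (cLnorm p f <= pnorm p (Re \o f) + pnorm p (Im \o f))%E.
Proof.
move=> p1 mr mi; have p0 : 0 < p by lra.
have ma (g : R -> R) : measurable_fun setT g -> measurable_fun setT (fun x => `|g x| : R).
  by move=> mg; exact: measurableT_comp.
have npa (g : R -> R) : measurable_fun setT g -> (pnorm p (fun x => `|g x|)%R <= pnorm p g)%E.
  by move=> mg; apply: pnorm_mono => //; [exact: ma|move=> x; rewrite normr_id].
rewrite cLnorm_np.
apply: le_trans (leeD (npa _ mr) (npa _ mi)).
apply: le_trans (pnorm_triangle p1 (ma _ mr) (ma _ mi)).
apply: pnorm_mono => //; first exact: measurable_normc.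
  by apply: measurable_funD; exact: ma.
move=> x; rewrite [leRHS]ger0_norm ?addr_ge0 //= ger0_norm ?normc_le_ReIm //.
exact: normc_ge0.
Qed.

Lemma cLfun_Re_Im p f : 0 < p -> cLfun p f ->
  (pnorm p (Re \o f) < +oo)%E /\ (pnorm p (Im \o f) < +oo)%E.
Proof.
move=> p0 [mr mi ff]; have mn := measurable_normc mr mi.
have n0 z : `|normc z| = normc z by rewrite ger0_norm // normc_ge0.
split; apply: le_lt_trans ff; apply: pnorm_mono => // x /=; rewrite n0.
  exact: normr_Re_le.
exact: normr_Im_le.
Qed.

Lemma cLfun_translate p (g : R -> R) a : 1 <= p -> measurable_fun setT g ->
  (pnorm p g < +oo)%E -> cLfun p (translate g a).
Proof.
move=> p1 mg gfin; have ms := measurable_shiftf a mg.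
split=> //; first exact: measurable_cst.
rewrite cLnorm_np (_ : _ \o _ = fun x => `|shiftf g a x|); last first.
  by apply/funext => x; rewrite /comp normcE /= expr0n addr0 sqrtr_sqr.
apply: le_lt_trans gfin; rewrite -(pnorm_shift p a mg).
by apply: pnorm_mono => //; [lra|exact: measurableT_comp|move=> x; rewrite normr_id].
Qed.

(** The translates are real, so the real and imaginary parts of a target are
    approximated separately; coefficients are padded with 0 to a common length. *)
Lemma complete_of_real p (g : R -> R) (lam : nat -> R) : 1 < p ->
  measurable_fun setT g -> (pnorm p g < +oo)%E ->
  (forall f : R -> R, measurable_fun setT f -> (pnorm p f < +oo)%E ->
     approx p (fun n => shiftf g (lam n)) f) ->
  complete_in_Lp p (fun n => translate g (lam n)).
Proof.
move=> p1 mg gfin all; have p1' := ltW p1; have p0 : 0 < p by lra.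
split=> [n|f cf e e0]; first exact: cLfun_translate.
have [fr fi] := cLfun_Re_Im p0 cf; have [mr mi _] := cf.
pose v n := shiftf g (lam n).
have mv n : measurable_fun setT (v n) by exact: measurable_shiftf.
have lin (h : R -> R) : approx p v h -> exists N (c : nat -> R), forall M, (N <= M)%N ->
    (pnorm p (fun x => h x - \sum_(k < M) (if (k < N)%N then c k else 0) * v k x)%R <= (e / 3)%:E)%E.
  move=> [_ /(_ (e / 3) ltac:(lra)) [N [c hc]]]; exists N, c => M NM.
  rewrite (_ : (fun x => _) = fun x => h x - \sum_(k < N) c k * v k x) //.
  by apply/funext => x; rewrite (@sum_pad _ c (v ^~ x) N M NM).
have [N1 [c1 h1]] := lin _ (all _ mr fr); have [N2 [c2 h2]] := lin _ (all _ mi fi).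
pose M := maxn N1 N2.
pose C k := Complex (if (k < N1)%N then c1 k else 0) (if (k < N2)%N then c2 k else 0).
exists (fun x => \sum_(k < M) C k * translate g (lam k) x); first by exists M, C.
have reE : Re \o (f \- (fun x => \sum_(k < M) C k * translate g (lam k) x)) =
    fun x => Re (f x) - \sum_(k < M) (if (k < N1)%N then c1 k else 0) * v k x.
  apply/funext => x; rewrite /= raddfB raddf_sum; congr (_ - _); apply: eq_bigr => k _.
  by rewrite /= mulr0 subr0.
have imE : Im \o (f \- (fun x => \sum_(k < M) C k * translate g (lam k) x)) =
    fun x => Im (f x) - \sum_(k < M) (if (k < N2)%N then c2 k else 0) * v k x.
  apply/funext => x; rewrite /= raddfB raddf_sum; congr (_ - _); apply: eq_bigr => k _.
  by rewrite /= mulr0 add0r.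
have ml (h : R -> R) (d : nat -> R) : measurable_fun setT h ->
    measurable_fun setT (fun x => h x - \sum_(k < M) d k * v k x).
  move=> mh; apply: measurable_funB => //; apply: measurable_sum => k.
  by apply: measurable_funM; [exact: measurable_cst|exact: mv].
apply: le_lt_trans (cLnorm_le_ReIm p1' _ _) _.
- by rewrite reE; exact: (ml (Re \o f) (fun k => if (k < N1)%N then c1 k else 0)).
- by rewrite imE; exact: (ml (Im \o f) (fun k => if (k < N2)%N then c2 k else 0)).
rewrite reE imE; apply: le_lt_trans (leeD (h1 M (leq_maxl _ _)) (h2 M (leq_maxr _ _))) _.
by rewrite -EFinD lte_fin; lra.
Qed.

End Complexification.

Lemma Lfun_pnorm (R : realType) (p : R) (g : R -> R) : measurable_fun setT g -> (pnorm p g < +oo)%E ->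
  g \in Lfun (@lebesgue_measure R) p%:E.
Proof.
move=> mg gfin; rewrite inE; apply/andP; split; first by rewrite inE.
by rewrite inE.
Qed.

Lemma stage_exponent_le (R : realType) (p : R) : 1 < p -> exists K, forall k, (K <= k)%N -> stage_exponent k <= p.
Proof.
move=> p1; have p10 : 0 < p - 1 by lra.
exists (Num.truncn (p - 1)^-1) => k kK; rewrite /stage_exponent -lerBrDl.
rewrite invf_ple ?posrE //; apply: ltW; apply: lt_le_trans (truncnS_gt _) _.
by rewrite ler_nat.
Qed.

Theorem theorem2p1 (R : realType) (eps : nat -> R) (lambda0 : R)
  (eps_gt0 : forall n, 0 < eps n)
  (eps_cvg0 : eps n @[n --> \oo] --> (0 : R))
  (lambda0_gt0 : 0 < lambda0) :
  exists (g : R -> R) (lambda : nat -> R),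
    [/\ (forall x, 0 <= g x) /\
          (forall p : R, 1 < p -> g \in Lfun (@lebesgue_measure R) p%:E),
        lambda 0%N = lambda0 /\ (forall n, (0 < n)%N -> 0 < lambda n),
        forall n, lambda n.+1 / lambda n > 1 + eps n &
        forall p : R, 1 < p -> complete_in_Lp p (fun n => translate g (lambda n.+1))].
Proof.
have [lam [F [b [c [D [l [lam0 hlam nb H]]]]]]] := construction eps_gt0 eps_cvg0 lambda0_gt0.
have niceF k : nice (F k) by have [] := nb k.
have b_gt0 k : 0 < b k by have [] := nb k.
have b_half k : b k.+1 <= b k / 2 by have [_ _ _ _ []] := H k.
have F_step k x : F k x <= F k.+1 x <= F k x + b k by have [_ + _ _ _] := H k; exact.
have mg := measurable_flim niceF b_gt0 b_half F_step.
have gfin p : 1 < p -> (pnorm p (flim F) < +oo)%E.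
  move=> p1; have [K hK] := stage_exponent_le p1.
  apply: (pnorm_flim_fin (K := K) niceF b_gt0 b_half F_step p1) => k Kk.
  by have [_ _ [+ _] _ _] := H k; apply; exact: hK.
exists (flim F), lam; split.
- split; first exact: (flim_ge0 niceF b_gt0 b_half F_step).
  by move=> p p1; apply: Lfun_pnorm => //; exact: gfin.
- by split => // n _; have [] := hlam n.
- by move=> n; have [lp lr] := hlam n; rewrite ltr_pdivlMr.
move=> p p1; have [K hK] := stage_exponent_le p1.
apply: (complete_of_real (lam := fun n => lam n.+1)) => // [|f mf ffin]; first exact: gfin.
have [c0 freq] : (forall k, (c k)`_0 = 0) /\ (forall k i, (0 < i < size (c k))%N ->
    exists n, lam n.+1 = ratr (rat_enum k) + i%:R * (D k)%:R).
  by split => k; have [[]] := H k.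
apply: (@approx_Lp _ F b niceF b_gt0 b_half F_step p K p1 _ c D l lam c0 freq) => // k.
- by move=> Kk; have [_ _ [+ _] _ _] := H k; apply; exact: hK.
- by move=> Kk; have [_ _ [_ +] _ _] := H k; apply; exact: hK.
- by have [_ _ _ + _] := H k; apply; exact: ltW.
- by have [_ _ _ _ []] := H k.
- by have [_ _ _ _ []] := H k.
Qed.
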